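(* Let $\Gamma$ be a graph (finite or infinite). The right-angled Artin group $A\Gamma$ is poly-free of length $2$ (that is, $\mathrm{pfl}(A\Gamma)=2$) if and only if $\Gamma$ has the doubly breakable cycle property.
   Context: All graphs are simple undirected graphs $\Gamma=(V(\Gamma),E(\Gamma))$ (no loops or multiple edges), possibly infinite. The right-angled Artin group $A\Gamma$ is the group with generating set $V(\Gamma)$ and defining relations $vw=wv$ for each edge $\{v,w\}\in E(\Gamma)$. A cycle in $\Gamma$ is a path of length at least $3$ in which no vertex is repeated except that the initial and terminal vertices coincide. The graph $\Gamma$ has the doubly breakable cycle property if $\Gamma$ is not totally disconnected (i.e. it has at least one edge) and there exists a subset $D\subseteq V(\Gamma)$ such that no two vertices of $D$ are adjacent and every cycle in $\Gamma$ contains at least two vertices in $D$. A group $G$ is poly-free if there is a finite chain of subgroups $1=G_0\trianglelefteq G_1\trianglelefteq\cdots\trianglelefteq G_N=G$ (each $G_i$ normal in $G_{i+1}$) such that each quotient $G_{i+1}/G_i$ is a free group (of finite or infinite rank); the poly-free length $\mathrm{pfl}(G)$ is the least $N$ for which such a chain exists. *)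

(* Defs.v *)
(* MathComp with classical axioms from boolp. Groups are groupType (monoid.v),
   which need not be finite. *)
From HB Require Import structures.
From mathcomp Require Import all_boot.
From mathcomp Require Import boolp.

Set Implicit Arguments.
Unset Strict Implicit.
Unset Printing Implicit Defensive.

Local Open Scope quotient_scope.
Local Open Scope group_scope.

(* The letter (s, true) stands for the generator s, and (s, false) for its
   inverse. *)
Notation word S := (seq (S * bool)%type).

Section Presentation.
Variable S : choiceType.
Local Notation word := (seq (S * bool)).

Definition inv_letter (l : S * bool) : S * bool := (l.1, ~~ l.2).
Definition inv_word (w : word) : word := rev (map inv_letter w).

Variable R : word -> word -> Prop.

Inductive word_eq : word -> word -> Prop :=
  | WordRefl u : word_eq u u
  | WordSym u v : word_eq u v -> word_eq v u
  | WordTrans u v w : word_eq u v -> word_eq v w -> word_eq u w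
  | WordCat u u' v v' : word_eq u u' -> word_eq v v' ->
      word_eq (u ++ v) (u' ++ v')
  | WordCancel l : word_eq [:: l; inv_letter l] [::]
  | WordRel u v : R u v -> word_eq u v.

Definition word_eqb : rel word := fun u v => `[< word_eq u v >].

Lemma word_eqb_refl : reflexive word_eqb.
Proof. by move=> u; apply/asboolP; exact: WordRefl. Qed.

Lemma word_eqb_sym : symmetric word_eqb.
Proof. by move=> u v; apply/asboolP/asboolP; exact: WordSym. Qed.

Lemma word_eqb_trans : transitive word_eqb.
Proof.
by move=> v u w /asboolP uv /asboolP vw; apply/asboolP; exact: WordTrans uv vw.
Qed.

Canonical word_equiv := EquivRel word_eqb word_eqb_refl word_eqb_sym
  word_eqb_trans.

(* The group < S | u = v for all u, v with R u v >. *)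
Definition presented : Type := {eq_quot word_equiv}.
HB.instance Definition _ := Choice.on presented.
HB.instance Definition _ := EqQuotient.on presented.

Lemma presented_eqP (u v : word) :
  \pi_presented u = \pi_presented v <-> word_eq u v.
Proof.
split; first by move/eqquotP/asboolP.
by move=> uv; apply/eqquotP/asboolP.
Qed.

Lemma word_eq_repr (u : word) : word_eq (repr (\pi_presented u)) u.
Proof. by apply/presented_eqP; rewrite reprK. Qed.

Lemma inv_letterK : involutive inv_letter.
Proof. by case=> s b; rewrite /inv_letter /= negbK. Qed.

Lemma inv_wordK : involutive inv_word.
Proof.
by move=> w; rewrite /inv_word map_rev revK -map_comp map_id_in // => l _;
  exact: inv_letterK.
Qed.

Lemma word_eq_mulV (w : word) : word_eq (w ++ inv_word w) [::].
Proof.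
elim: w => [|l w IHw]; first exact: WordRefl.
rewrite /inv_word map_cons rev_cons -/(inv_word w) -cats1 -cat1s -catA.
rewrite (catA w); apply: WordTrans (WordCancel l).
apply: (WordCat (u := [:: l]) (u' := [:: l])); first exact: WordRefl.
rewrite -[X in word_eq _ X]cat0s; apply: WordCat IHw _; exact: WordRefl.
Qed.

Lemma word_eq_mulVl (w : word) : word_eq (inv_word w ++ w) [::].
Proof. by have := word_eq_mulV (inv_word w); rewrite inv_wordK. Qed.

Lemma word_eq_inv (u v : word) : word_eq u v ->
  word_eq (inv_word u) (inv_word v).
Proof.
move=> uv; apply: WordTrans (_ : word_eq (inv_word u ++ (v ++ inv_word v)) _).
  rewrite -[X in word_eq X _]cats0; apply: WordCat; first exact: WordRefl.
  exact: WordSym (word_eq_mulV v).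
rewrite catA -[X in word_eq _ X]cat0s; apply: WordCat; last exact: WordRefl.
apply: WordTrans (word_eq_mulVl u); apply: WordCat; first exact: WordRefl.
exact: WordSym.
Qed.

Definition presented_mul (x y : presented) : presented :=
  \pi_presented (repr x ++ repr y : word).
Definition presented_one : presented := \pi_presented ([::] : word).
Definition presented_inv (x : presented) : presented :=
  \pi_presented (inv_word (repr x)).

Lemma presented_mulE (u v : word) :
  presented_mul (\pi_presented u) (\pi_presented v) = \pi_presented (u ++ v).
Proof. by apply/presented_eqP; apply: WordCat; exact: word_eq_repr. Qed.

Lemma presented_invE (u : word) :
  presented_inv (\pi_presented u) = \pi_presented (inv_word u).
Proof. by apply/presented_eqP; apply: word_eq_inv; exact: word_eq_repr. Qed.

Lemma presented_mulA : associative presented_mul.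
Proof.
move=> x y z; rewrite -[x]reprK -[y]reprK -[z]reprK.
by rewrite (presented_mulE (repr y)) (presented_mulE (repr x))
  (presented_mulE (repr x)) (presented_mulE _ (repr z)) catA.
Qed.

Lemma presented_mul1 : left_id presented_one presented_mul.
Proof. by move=> x; rewrite -[x]reprK presented_mulE. Qed.

Lemma presented_mulr1 : right_id presented_one presented_mul.
Proof. by move=> x; rewrite -[x]reprK presented_mulE cats0. Qed.

Lemma presented_mulV : left_inverse presented_one presented_inv presented_mul.
Proof.
move=> x; rewrite -[x]reprK presented_invE presented_mulE.
by apply/presented_eqP; exact: word_eq_mulVl.
Qed.

Lemma presented_mulrV : right_inverse presented_one presented_inv presented_mul.
Proof.
move=> x; rewrite -[x]reprK presented_invE presented_mulE.
by apply/presented_eqP; exact: word_eq_mulV.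
Qed.

HB.instance Definition _ := isGroup.Build presented presented_mulA
  presented_mul1 presented_mulr1 presented_mulV presented_mulrV.

End Presentation.

Definition free_group (S : choiceType) : groupType :=
  presented (fun _ _ : word S => False).

Definition isomorphic (G H : groupType) : Prop :=
  exists f : {multiplicative G -> H}, bijective f.

Definition is_free (G : groupType) : Prop :=
  exists S : choiceType, isomorphic G (free_group S).

Section Quotient.
Variable G : groupType.
Implicit Types H K : groupClosed G.

Definition subgroup_type K : Type := {x : G | x \in K}.
HB.instance Definition _ K := SubChoice.on (subgroup_type K).

Lemma subgroup_closed K : group_closed [pred x : G | x \in K].
Proof. by split=> [|x y xK yK]; [exact: gpred1 | exact: gpredF]. Qed.

HB.instance Definition _ K :=
  SubChoice_isSubGroup.Build G _ (subgroup_type K) (subgroup_closed K).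

Record normal_in H K : Prop := NormalIn {
  normal_sub : {subset H <= K};
  normal_conj : {in H & K, forall h k, h ^ k \in H} }.

Definition same_coset H K : rel (subgroup_type K) :=
  fun x y => (val x)^-1 * val y \in H.

Lemma same_coset_refl H K : reflexive (@same_coset H K).
Proof. by move=> x; rewrite /same_coset mulVg gpred1. Qed.

Lemma same_coset_sym H K : symmetric (@same_coset H K).
Proof. by move=> x y; rewrite /same_coset -gpredV invgM invgK. Qed.

Lemma same_coset_trans H K : transitive (@same_coset H K).
Proof.
move=> y x z xy yz; rewrite /same_coset.
by rewrite -[val z](mulVKg (val y)) mulgA gpredM.
Qed.

Canonical coset_equiv H K := EquivRel (@same_coset H K)
  (@same_coset_refl H K) (@same_coset_sym H K) (@same_coset_trans H K).

(* The carrier K / H; normality is only needed for its group law, but it is an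
   argument of the type so that the group structure can be inferred. *)
Definition quotient H K (nHK : normal_in H K) : Type :=
  {eq_quot (coset_equiv H K)}.

Section Law.
Variables (H K : groupClosed G) (nHK : normal_in H K).
Local Notation Q := (quotient nHK).
HB.instance Definition _ := Choice.on Q.
HB.instance Definition _ := EqQuotient.on Q.

Definition quotient_mul (x y : Q) : Q := \pi_Q (repr x * repr y).
Definition quotient_one : Q := \pi_Q 1.
Definition quotient_inv (x : Q) : Q := \pi_Q (repr x)^-1.

Lemma quotient_eqP (x y : subgroup_type K) :
  \pi_Q x = \pi_Q y <-> (val x)^-1 * val y \in H.
Proof. by split=> [/eqquotP //|xy]; apply/eqquotP. Qed.

Lemma repr_coset (x : subgroup_type K) :
  (val (repr (\pi_Q x)))^-1 * val x \in H.
Proof. by apply/quotient_eqP; rewrite reprK. Qed.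

Lemma quotient_mulE (x y : subgroup_type K) :
  quotient_mul (\pi_Q x) (\pi_Q y) = \pi_Q (x * y).
Proof.
apply/quotient_eqP; rewrite !gmulfM /= invgM.
set x' := val (repr (\pi_Q x)); set y' := val (repr (\pi_Q y)).
have -> : y'^-1 * x'^-1 * (val x * val y) =
  (y'^-1 * val y) * (x'^-1 * val x) ^ val y.
  by rewrite /conjg !mulgA mulgK.
rewrite gpredM //; first exact: repr_coset.
by apply: normal_conj nHK _ _ _ _; [exact: repr_coset | exact: valP].
Qed.

Lemma quotient_mulA : associative quotient_mul.
Proof.
move=> x y z; rewrite -[x]reprK -[y]reprK -[z]reprK.
by rewrite (quotient_mulE (repr y)) (quotient_mulE (repr x))
  (quotient_mulE (repr x)) (quotient_mulE _ (repr z)) mulgA.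
Qed.

Lemma quotient_mul1 : left_id quotient_one quotient_mul.
Proof.
by move=> x; rewrite -[x]reprK /quotient_one (quotient_mulE 1) mul1g.
Qed.

Lemma quotient_mulr1 : right_id quotient_one quotient_mul.
Proof.
by move=> x; rewrite -[x]reprK /quotient_one (quotient_mulE _ 1) mulg1.
Qed.

Lemma quotient_mulV : left_inverse quotient_one quotient_inv quotient_mul.
Proof.
move=> x; rewrite -{2}[x]reprK /quotient_inv.
by rewrite (quotient_mulE (repr x)^-1 (repr x)) mulVg.
Qed.

Lemma quotient_mulrV : right_inverse quotient_one quotient_inv quotient_mul.
Proof.
move=> x; rewrite -{1}[x]reprK /quotient_inv.
by rewrite (quotient_mulE (repr x) (repr x)^-1) mulgV.
Qed.

HB.instance Definition _ := isGroup.Build Q quotient_mulA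
  quotient_mul1 quotient_mulr1 quotient_mulV quotient_mulrV.
End Law.
End Quotient.

(* Only H 0, ..., H N matter. *)
Definition poly_free_chain (G : groupType) (N : nat)
    (H : nat -> groupClosed G) : Prop :=
  [/\ H 0 =i pred1 1, H N =i predT &
    forall i, i < N -> exists nH : normal_in (H i) (H i.+1),
      is_free (quotient nH)].

Definition has_poly_free_chain (G : groupType) (N : nat) : Prop :=
  exists H : nat -> groupClosed G, poly_free_chain N H.

(* pfl(G) = N; in particular, G is poly-free. *)
Definition pfl_eq (G : groupType) (N : nat) : Prop :=
  has_poly_free_chain G N /\ forall M, has_poly_free_chain G M -> N <= M.

(* The choiceType structure and the boolean adj are no restriction on a possibly
   infinite graph: boolp provides both for an arbitrary type and relation. *)
Record graph := Graph {
  vertex :> choiceType;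
  adj : rel vertex;
  adj_sym : symmetric adj;
  adj_irr : irreflexive adj }.

Section Graph.
Variable Gamma : graph.

Definition edge_commutation (u v : word Gamma) : Prop :=
  exists x y : Gamma, [/\ adj x y,
    u = [:: (x, true); (y, true)] & v = [:: (y, true); (x, true)]].

Definition raag : groupType := presented edge_commutation.

(* The cycle (v_0, ..., v_(n-1), v_0) is encoded by [:: v_0; ...; v_(n-1)]:
   ucycle includes the closing edge from the last vertex to the first. *)
Definition graph_cycle (c : seq Gamma) : Prop :=
  2 < size c /\ ucycle (@adj Gamma) c.

Definition doubly_breakable_cycle_property : Prop :=
  (exists x y : Gamma, adj x y) /\
  exists D : {pred Gamma},
    {in D &, forall x y, ~~ adj x y} /\
    forall c, graph_cycle c ->
      exists x y, [/\ x \in c, y \in c, x \in D, y \in D & x != y].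

End Graph.

(* Main.v *)
(* Let K be a free normal subgroup of the group A = A(Gamma) with free quotient
   F, and D the set of vertices lying in K. Additive functions a, b : A -> Z
   lift on K to a homomorphism into the Heisenberg group, that is, there is
   c : K -> Z with c(kk') = c(k) + c(k') + a(k) b(k'); hence commuting x, y in K
   satisfy a(x) b(y) = a(y) b(x), and D is independent. Commuting nontrivial
   elements of F have a common power, so the vertices of a path avoiding D have
   powers u_1, ..., u_n with the same image in F. If a cycle has only the vertex
   w in D, then w commutes with u_1^-1 u_n for its neighbours u_1, u_n, which
   contradicts the determinant identity. If it avoids D, conjugation by u_1
   changes c by a homomorphism whose value on u_1^-1 u_(i+1) = (u_1^-1 u_i)
   (u_i^-1 u_(i+1)) can be computed, as u_i and u_(i+1) commute; going round the
   cycle gives sum_i a(u_i) b(u_(i+1)) - b(u_i) a(u_(i+1)) = 0, which fails for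
   the exponents a, b of two consecutive vertices.

   Conversely, given D, the complement of D is a forest, and a vertex of D has
   at most one neighbour in each tree. Let p map A to the free group F on the
   trees, the vertices of D to 1 and the other ones to their tree; the roots of
   the trees give a section s of p. The kernel of p is generated by the elements
   e(v, g) = s(p(v) g)^-1 v s(g). The relation between v and an adjacent w in the
   tree T expresses e(v, T g) by e(v, g) and elements for w. Taking w to be the
   parent of v, or, for v in D, the neighbour of v in T, one can solve these
   relations for the longer of g and T g, and the remaining e(v, g) form a basis
   of the kernel. *)
Require Import Defs.
From HB Require Import structures.
From mathcomp Require Import all_boot all_algebra.
From mathcomp Require Import boolp.
From mathcomp Require Import ring zify.

Set Implicit Arguments.
Unset Strict Implicit.
Unset Printing Implicit Defensive.

Import GRing.Theory Num.Theory.
Local Open Scope quotient_scope.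
Local Open Scope group_scope.

(** * Presented groups and free quotients *)

Section MorphTheory.
Variables (G H : groupType) (f : G -> H).
Hypothesis fM : {morph f : x y / x * y}.

Lemma morph_mul1 : f 1 = 1.
Proof. by apply: (@mulgI _ (f 1)); rewrite -fM !mulg1. Qed.

Lemma morph_mulV : {morph f : x / x^-1}.
Proof.
by move=> x; apply: (@mulgI _ (f x)); rewrite -fM !mulgV morph_mul1.
Qed.

Lemma morph_mulX n : {morph f : x / x ^+ n}.
Proof.
by move=> x; elim: n => [|n IHn]; rewrite ?morph_mul1 // !expgS fM IHn.
Qed.
End MorphTheory.

Section WordValue.
Variables (S : choiceType) (G : groupType) (h : S -> G).

Definition letter_val (l : S * bool) : G := if l.2 then h l.1 else (h l.1)^-1.
Definition word_val (w : word S) : G := \prod_(l <- w) letter_val l.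

Lemma word_val_cat u v : word_val (u ++ v) = word_val u * word_val v.
Proof. exact: big_cat. Qed.

Lemma word_val_cons l w : word_val (l :: w) = letter_val l * word_val w.
Proof. exact: big_cons. Qed.

Lemma word_val1 l : word_val [:: l] = letter_val l.
Proof. exact: big_seq1. Qed.

Lemma letter_valV l : letter_val (inv_letter l) = (letter_val l)^-1.
Proof. by case: l => s [] //; rewrite /letter_val /= invgK. Qed.

Variable R : word S -> word S -> Prop.
Hypothesis hR : forall u v, R u v -> word_val u = word_val v.

Lemma word_val_eq u v : word_eq R u v -> word_val u = word_val v.
Proof.
elim=> {u v} // [u v w _ -> _ ->|u u' v v' _ uu' _ vv'|l].
- by [].
- by rewrite !word_val_cat uu' vv'.
- by rewrite word_val_cons word_val1 letter_valV mulgV /word_val big_nil.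
Qed.

Definition presented_lift (x : presented R) : G := word_val (repr x).

Lemma presented_liftE u : presented_lift (\pi u) = word_val u.
Proof. exact/word_val_eq/word_eq_repr. Qed.

Lemma presented_piM (u v : word S) :
  \pi_(presented R) (u ++ v) = \pi_(presented R) u * \pi_(presented R) v.
Proof. exact: esym (presented_mulE R u v). Qed.

Lemma presented_liftM : {morph presented_lift : x y / x * y}.
Proof.
move=> x y; rewrite -[x]reprK -[y]reprK -presented_piM !presented_liftE.
exact: word_val_cat.
Qed.

End WordValue.
Arguments presented_lift {S G} h {R} x.

Section Generators.
Variables (S : choiceType) (R : word S -> word S -> Prop).

Definition gen (s : S) : presented R := \pi [:: (s, true)].

Lemma pi_word_val (u : word S) : \pi_(presented R) u = word_val gen u.
Proof.
elim: u => [|[s b] u IHu]; first by rewrite /word_val big_nil.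
rewrite -cat1s presented_piM IHu word_val_cat word_val1; congr (_ * _).
by case: b => //; exact: esym (presented_invE R [:: (s, true)]).
Qed.

Lemma presented_lift_gen (G : groupType) (h : S -> G) :
  (forall u v, R u v -> word_val h u = word_val h v) ->
  forall s, presented_lift h (gen s) = h s.
Proof. by move=> hR s; rewrite presented_liftE // word_val1. Qed.

Lemma presented_ind (P : presented R -> Prop) :
  P 1 -> (forall s x, P x -> P (gen s * x)) ->
  (forall s x, P x -> P ((gen s)^-1 * x)) -> forall x, P x.
Proof.
move=> P1 PM PV x; rewrite -[x]reprK pi_word_val.
elim: (repr x) => [|[s b] w IHw]; first by rewrite /word_val big_nil.
by rewrite word_val_cons; case: b; [exact: PM | exact: PV].
Qed.

Lemma presented_ext (G : groupType) (f g : presented R -> G) :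
  {morph f : x y / x * y} -> {morph g : x y / x * y} ->
  (forall s, f (gen s) = g (gen s)) -> f =1 g.
Proof.
move=> fM gM fg; apply: presented_ind => [|s x IHx|s x IHx].
- by rewrite !morph_mul1.
- by rewrite fM gM IHx fg.
- by rewrite fM gM IHx !morph_mulV // fg.
Qed.

End Generators.
Arguments gen {S R}.

Lemma free_group_rel (S : choiceType) (G : groupType) (h : S -> G)
  (u v : word S) : (fun _ _ : word S => False) u v ->
  word_val h u = word_val h v.
Proof. by []. Qed.

Section FreeQuotient.
Variables (G : groupType) (H K : groupClosed G) (nHK : normal_in H K).
Local Notation Q := (quotient nHK).

Lemma pi_quotientM (x y : subgroup_type K) : \pi_Q (x * y) = \pi_Q x * \pi_Q y.
Proof. exact: esym (quotient_mulE nHK x y). Qed.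

(** Followed by the projection to [K / H], [phi] becomes bijective. Every quotient of the
    constructed chains is shown to be free in this way. *)
Lemma quotient_is_free (X : choiceType) (phi : free_group X -> G) :
  {morph phi : x y / x * y} -> (forall x, phi x \in K) ->
  (forall x, phi x \in H -> x = 1) ->
  {in K, forall k, exists x, k^-1 * phi x \in H} -> is_free Q.
Proof.
move=> phiM phiK phi_inj phi_surj.
pose g x : Q := \pi_Q (exist _ (phi x) (phiK x) : subgroup_type K).
have gM : {morph g : x y / x * y}.
  move=> x y; rewrite -pi_quotientM; congr (\pi_Q _).
  by apply: val_inj; rewrite /= phiM.
have g_inj : injective g.
  move=> x y /quotient_eqP /=; rewrite -(morph_mulV phiM) -phiM => /phi_inj xy.
  by rewrite -[y](mulVKg x) xy mulg1.
have g_surj q : exists x, g x = q.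
  have [x xH] := phi_surj _ (valP (repr q)).
  by exists x; rewrite -[q]reprK; apply/esym/quotient_eqP.
pose f q := sval (cid (g_surj q)).
have gf : cancel f g by move=> q; exact: svalP (cid (g_surj q)).
have fg : cancel g f by move=> x; apply: g_inj; rewrite gf.
have fM : {morph f : x y / x * y}.
  by move=> x y; apply: g_inj; rewrite gM !gf.
pose f' : {multiplicative Q -> free_group X} :=
  HB.pack f (isMultiplicative.Build Q (free_group X) f fM).
by exists X, f'; exists g.
Qed.

(** Trades the quotient type for maps on [G]: [g] has the default value 1 outside [K], and [j] only
    picks coset representatives, so it need not be multiplicative. *)
Lemma quotient_free_coord : is_free Q ->
  exists (S : choiceType) (g : G -> free_group S) (j : free_group S -> G),
  [/\ {in K &, {morph g : x y / x * y}}, forall x, j x \in K, cancel j g &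
      {in K, forall k, g k = 1 <-> k \in H}].
Proof.
case=> S [f [f' fK f'K]]; exists S.
pose g k := if insub k is Some x then f (\pi_Q (x : subgroup_type K)) else 1.
have gE x (xK : x \in K) :
    g x = f (\pi_Q (exist _ x xK : subgroup_type K)).
  by rewrite /g insubT.
exists g, (fun x => val (repr (f' x))); split.
- move=> x y xK yK; rewrite !gE; first exact: gpredM.
  move=> xyK; rewrite -gmulfM -pi_quotientM; congr (f (\pi_Q _)).
  exact: val_inj.
- by move=> x; exact: valP.
- move=> x /=; rewrite gE; first exact: valP.
  move=> p; rewrite -[RHS]f'K -[X in f X = _]reprK -[in RHS](reprK (f' x)).
  by rewrite reprK; congr (f (\pi_Q _)); exact: val_inj.
- have f1 : f 1 = 1 by exact: (morph_mul1 (@gmulfM _ _ f)).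
  move=> k kK; rewrite gE; split=> [gk1|kH].
    have := congr1 f' gk1; rewrite fK -f1 fK => /esym/quotient_eqP /=.
    by rewrite invg1 mul1g.
  rewrite -f1; congr (f _); apply/esym/quotient_eqP.
  by rewrite /= invg1 mul1g.
Qed.

End FreeQuotient.

(** * The Heisenberg group and lifts of additive functions *)

Definition heisenberg : Type := (int * int * int)%type.
HB.instance Definition _ := Choice.on heisenberg.

Section Heisenberg.
Local Open Scope ring_scope.
Implicit Types x y z : heisenberg.

(* (a, b, c) stands for [[1, a, c], [0, 1, b], [0, 0, 1]]. *)
Definition heis_mul x y : heisenberg :=
  (x.1.1 + y.1.1, x.1.2 + y.1.2, x.2 + y.2 + x.1.1 * y.1.2).
Definition heis_one : heisenberg := (0, 0, 0).
Definition heis_inv x : heisenberg := (- x.1.1, - x.1.2, - x.2 + x.1.1 * x.1.2).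

Lemma heis_mulA : associative heis_mul.
Proof.
by move=> [[a b] c] [[a' b'] c'] [[a'' b''] c'']; congr (_, _, _); rewrite /=;
  ring.
Qed.

Lemma heis_mul1 : left_id heis_one heis_mul.
Proof. by move=> [[a b] c]; congr (_, _, _); rewrite /=; ring. Qed.

Lemma heis_mulr1 : right_id heis_one heis_mul.
Proof. by move=> [[a b] c]; congr (_, _, _); rewrite /=; ring. Qed.

Lemma heis_mulV : left_inverse heis_one heis_inv heis_mul.
Proof. by move=> [[a b] c]; congr (_, _, _); rewrite /=; ring. Qed.

Lemma heis_mulrV : right_inverse heis_one heis_inv heis_mul.
Proof. by move=> [[a b] c]; congr (_, _, _); rewrite /=; ring. Qed.
End Heisenberg.

HB.instance Definition _ := isGroup.Build heisenberg heis_mulA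
  heis_mul1 heis_mulr1 heis_mulV heis_mulrV.

Definition additive_on (G : groupType) (a : G -> int) : Prop :=
  forall x y, a (x * y) = (a x + a y)%R.

Section Additive.
Variables (G : groupType) (a : G -> int).
Hypothesis aM : additive_on a.

Lemma additive1 : a 1 = 0%R.
Proof. by apply: (addrI (a 1)); rewrite -aM mulg1 addr0. Qed.

Lemma additiveV x : a x^-1 = (- a x)%R.
Proof. by apply: (addrI (a x)); rewrite -aM mulgV additive1 subrr. Qed.

Lemma additiveJ x y : a (x ^ y) = a x.
Proof. by rewrite /conjg !aM additiveV; ring. Qed.

Lemma additiveX x n : a (x ^+ n) = (a x *+ n)%R.
Proof.
by elim: n => [|n IHn]; rewrite ?additive1 // expgS aM IHn mulrS.
Qed.
End Additive.

Section TrivialQuotient.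
Variables (G : groupType) (H K : groupClosed G) (nHK : normal_in H K).
Hypotheses (H1 : H =i pred1 1) (freeK : is_free (quotient nHK)).

(* The map k |-> (a k, b k) from the free group K to Z^2 lifts to the
   Heisenberg group. *)
Lemma free_heisenberg_lift (a b : G -> int) :
  additive_on a -> additive_on b -> exists c : G -> int,
  {in K &, forall x y, c (x * y) = (c x + c y + a x * b y)%R}.
Proof.
move=> aM bM; have [S [g [j [gM jK gj gH]]]] := quotient_free_coord freeK.
(* As [H] is trivial, [g] is injective on [K], which makes its section [j] a homomorphism. *)
have g_inj : {in K &, injective g}.
  move=> x y xK yK gxy; have xyK : x^-1 * y \in K by rewrite gpredM ?gpredV.
  have: x^-1 * y \in H.
    apply/(gH _ xyK); apply: (@mulgI _ (g x)).
    by rewrite -gM // mulVKg mulg1 gxy.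
  by rewrite H1 inE => /eqP xy; rewrite -[y](mulVKg x) xy mulg1.
have jM : {morph j : x y / x * y}.
  by move=> x y; apply: g_inj; rewrite ?gpredM ?gM ?gj.
have jg : {in K, cancel g j} by move=> k kK; apply: g_inj; rewrite ?gj.
(* Freeness permits any third coordinate on the generators; 0 is a choice. *)
pose h s : heisenberg := (a (j (gen s)), b (j (gen s)), 0%R).
pose th : free_group S -> heisenberg := presented_lift h.
have thM : {morph th : x y / x * y} by exact/presented_liftM/free_group_rel.
have th_gen s : th (gen s) = h s by apply/presented_lift_gen/free_group_rel.
have th1 : forall x, (th x).1 = (a (j x), b (j x)).
  apply: presented_ind => [|s x IHx|s x IHx].
  - by rewrite !morph_mul1 // !additive1.
  - by rewrite thM jM aM bM th_gen [LHS]/= IHx.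
  - rewrite thM jM aM bM [LHS]/= IHx (morph_mulV thM) th_gen.
    by rewrite (morph_mulV jM) !additiveV.
exists (fun k => (th (g k)).2) => x y xK yK.
by rewrite gM // thM [LHS]/= !th1 /= !jg.
Qed.

(** The terms [c x + c y] are symmetric, so equating [c (x * y)] and [c (y * x)] leaves only the
    products. *)
Lemma free_commute_det (a b : G -> int) (x y : G) :
  additive_on a -> additive_on b -> x \in K -> y \in K -> commute x y ->
  (a x * b y = a y * b x)%R.
Proof.
move=> aM bM xK yK xy; have [c cM] := free_heisenberg_lift aM bM.
have := cM x y xK yK; rewrite xy cM // (addrC (c x)) => /addrI ->.
by [].
Qed.
End TrivialQuotient.

(** * Commuting elements of free groups *)

Section ReducedWords.
Variable S : choiceType.
Implicit Types (l : S * bool) (u v w : word S).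
Local Notation F := (free_group S).

Lemma free_piM u v : \pi_F (u ++ v) = \pi_F u * \pi_F v.
Proof. exact: presented_piM. Qed.

Definition reduced : pred (word S) := sorted (fun l l' => l' != inv_letter l).

Definition push l w : word S :=
  if w is l' :: w' then if l' == inv_letter l then w' else l :: w else [:: l].

Definition nf w : word S := foldr push [::] w.

Lemma reduced_behead l w : reduced (l :: w) -> reduced w.
Proof. exact: path_sorted. Qed.

Lemma reduced_push l w : reduced w -> reduced (push l w).
Proof.
case: w => [|l' w] //= lw; case: eqP => [_|/eqP ll'].
  exact: reduced_behead lw.
by rewrite /reduced /= ll' lw.
Qed.

Lemma pushK l w : reduced w -> push (inv_letter l) (push l w) = w.
Proof.
case: w => [|l' w] /=; first by rewrite inv_letterK eqxx.
case: eqP => [->|_] lw; last by rewrite /= inv_letterK eqxx.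
by case: w lw => [|l'' w] //= /andP[/negPf ->].
Qed.

Lemma reduced_foldr_push u w : reduced w -> reduced (foldr push w u).
Proof. by move=> rw; elim: u => //= l u; exact: reduced_push. Qed.

(** Van der Waerden's argument: letters act on reduced words by [push], inverse letters act by
    inverse maps, so words equal in the group act alike. *)
Lemma word_eq_foldr_push u v w : word_eq (fun _ _ => False) u v ->
  reduced w -> foldr push w u = foldr push w v.
Proof.
move=> uv; elim: uv w => {u v} //.
- by move=> u v _ IH w rw; rewrite IH.
- by move=> u v x _ IH _ IH' w rw; rewrite IH // IH'.
- move=> u u' v v' _ IHu _ IHv w rw; rewrite !foldr_cat IHv // IHu //.
  exact: reduced_foldr_push.
- by move=> l w rw /=; rewrite -{1}(inv_letterK l) pushK.
Qed.

Lemma nf_reduced w : reduced w -> nf w = w.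
Proof.
elim: w => //= l w IHw lw; rewrite /nf /= -/(nf w) IHw ?(reduced_behead lw) //.
by case: w lw {IHw} => //= l' w /andP[/negPf ->].
Qed.

Lemma reduced_nf w : reduced (nf w).
Proof. exact: reduced_foldr_push. Qed.

Lemma pi_push l w : \pi_F (push l w) = \pi_F (l :: w).
Proof.
case: w => [|l' w] //=; case: eqP => // ->; apply/presented_eqP.
rewrite -[l :: _]/([:: l; inv_letter l] ++ w) -[X in word_eq _ X _]cat0s.
apply: WordCat; last exact: WordRefl.
exact/WordSym/WordCancel.
Qed.

Lemma pi_nf w : \pi_F (nf w) = \pi_F w.
Proof.
elim: w => //= l w IHw; rewrite pi_push -cat1s free_piM IHw.
by rewrite -free_piM.
Qed.

Lemma pi_eq_nf u v : \pi_F u = \pi_F v -> nf u = nf v.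
Proof. by move/presented_eqP => uv; exact: word_eq_foldr_push. Qed.

Lemma size_push l w : size (push l w) <= (size w).+1.
Proof.
by case: w => [|l' w] //=; case: ifP => //= _; rewrite -addn2 leq_addr.
Qed.

Lemma size_nf w : size (nf w) <= size w.
Proof. by elim: w => //= l w IHw; apply: leq_trans (size_push _ _) _. Qed.

(** A [push] that cancels shortens the word, so equality of sizes rules out every cancellation. *)
Lemma size_nf_eq w : size (nf w) = size w -> nf w = w.
Proof.
elim: w => //= l w IHw sz.
have szw : size (nf w) = size w.
  by apply/eqP; rewrite eqn_leq size_nf -ltnS -sz size_push.
rewrite /nf /= -/(nf w) IHw // in sz *.
by case: w sz {IHw szw} => [|l' w] //=; case: ifP => //= _; lia.
Qed.

Lemma pi_inv_word w : \pi_F (inv_word w) = (\pi_F w)^-1.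
Proof. exact: esym (presented_invE _ w). Qed.

Lemma reduced_inv_word w : reduced w -> reduced (inv_word w).
Proof.
rewrite /reduced /inv_word rev_sorted sorted_map; apply: sub_sorted => l l'.
by rewrite /relpre /= inv_letterK; apply: contra => /eqP ->.
Qed.

Definition repeat_word n w : word S := flatten (nseq n w).

Lemma pi_repeat_word n w : \pi_F (repeat_word n w) = (\pi_F w) ^+ n.
Proof.
elim: n => [|n IHn] //; rewrite expgS -IHn -free_piM; congr (\pi_F _).
Qed.

Lemma size_repeat_word n w : size (repeat_word n w) = (n * size w)%N.
Proof. by rewrite size_flatten /shape map_nseq sumn_nseq mulnC. Qed.

Lemma repeat_word_comm n u v : u ++ v = v ++ u ->
  repeat_word n u ++ v = v ++ repeat_word n u.
Proof.
move=> uv; elim: n => [|n IHn]; first by rewrite cats0.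
by rewrite /repeat_word /= -/(repeat_word n u) -catA IHn !catA uv.
Qed.

(** The two powers commute as words and have the same size; both are thus the same prefix of one
    word. *)
Lemma word_comm_power u v : u ++ v = v ++ u ->
  repeat_word (size v) u = repeat_word (size u) v.
Proof.
move=> uv; have /esym := repeat_word_comm (size v) uv.
move/(repeat_word_comm (size u))/eqP.
by rewrite eqseq_cat ?size_repeat_word 1?mulnC // => /andP[/eqP ->].
Qed.

(* If there is no cancellation in [w ++ u], both [w ++ u] and [u ++ w] are
   shortest words for the same element, hence equal as words. *)
Lemma reduced_comm_power l u w : reduced (l :: u) -> reduced w ->
  l != inv_letter (last (inv_letter l) w) ->
  commute (\pi_F (l :: u)) (\pi_F w) ->
  (\pi_F (l :: u)) ^+ size w = (\pi_F w) ^+ (size u).+1.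
Proof.
move=> ru rw lw uw; rewrite -!pi_repeat_word -[(size u).+1]/(size (l :: u)).
rewrite word_comm_power //.
have rwu : reduced (w ++ (l :: u)).
  case: w rw lw {uw} => //= l' w.
  by rewrite /reduced /= cat_path => -> /= ->.
have nfE : nf ((l :: u) ++ w) = w ++ (l :: u).
  by rewrite -[RHS]nf_reduced //; apply: pi_eq_nf; rewrite !free_piM.
rewrite -nfE; apply/esym/size_nf_eq; rewrite nfE !size_cat; exact: addnC.
Qed.

Definition commensurable (G : groupType) (x y : G) : Prop :=
  exists n m : nat, [/\ 0 < n, 0 < m & x ^+ n = y ^+ m \/ x ^+ n = y ^- m].

Lemma commensurable_conj (G : groupType) (z x y : G) :
  commensurable (x ^ z) (y ^ z) -> commensurable x y.
Proof.
case=> n [m [n0 m0 xy]]; exists n, m; split=> //.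
case: xy; rewrite -!conjXg -?conjVg => /conjg_inj; by [left | right].
Qed.

(** Induction on the size of [u]. If [u] is cyclically reduced, then [u] or its inverse can follow
    [w] without cancellation; otherwise conjugation by its first letter shortens it by two. *)
Lemma reduced_commensurable u w : u != [::] -> w != [::] ->
  reduced u -> reduced w -> commute (\pi_F u) (\pi_F w) ->
  commensurable (\pi_F u) (\pi_F w).
Proof.
have [n] := ubnP (size u); elim: n u w => // n IHn [|l u] // w.
rewrite ltnS => szu _ w0 ru rw uw.
have w_gt0 : 0 < size w by case: (w) w0.
have [ul|ul] := eqVneq (last l u) (inv_letter l); last first.
  (* If [w] ends with the inverse of [l], the inverse word is used instead: it could cancel against
     [w] only if [last l u] were [inv_letter l]. This gives the negative exponent. *)
  have [lw|] := eqVneq l (inv_letter (last (inv_letter l) w)); last first.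
    move=> lw; exists (size w), (size u).+1; split=> //; left.
    exact: reduced_comm_power.
  have uVE : inv_word (l :: u) =
    inv_letter (last l u) :: inv_word (belast l u).
    by rewrite lastI /inv_word map_rcons rev_rcons.
  exists (size w), (size u).+1; split=> //; right.
  apply: invg_inj; rewrite invgK -expVgn -pi_inv_word uVE.
  have -> : size u = size (inv_word (belast l u)).
    by rewrite size_rev size_map size_belast.
  apply: reduced_comm_power => //.
  - by rewrite -uVE; exact: reduced_inv_word.
  - case: (w) w0 lw => //= l' w' _ <-.
    by apply: contraNneq ul => lE; rewrite -[X in inv_letter X]lE inv_letterK.
  - by rewrite -uVE pi_inv_word; apply/commute_sym/commuteV/commute_sym.
case/lastP: u => [|u l'] in szu ru uw ul *.
  by case: l ul {szu ru uw} => s [] /eqP; rewrite xpair_eqE andbF.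
rewrite last_rcons in ul; rewrite {l'}ul in szu ru uw *.
have LV : \pi_F [:: inv_letter l] = (\pi_F [:: l])^-1 by rewrite -pi_inv_word.
have uE : \pi_F (l :: rcons u (inv_letter l)) ^ \pi_F [:: l] = \pi_F u.
  rewrite -cats1 -cat_cons -[l :: u]cat1s !free_piM LV conjgE !mulgA.
  by rewrite mulVg mul1g mulgVK.
(* The induction bounds only the first word, so the conjugate of [w] may be longer than [w]. *)
pose w' := nf (inv_letter l :: rcons w l).
have wE : \pi_F w ^ \pi_F [:: l] = \pi_F w'.
  by rewrite pi_nf -cats1 -[_ :: _ ++ _]cat1s !free_piM LV conjgE.
apply: (@commensurable_conj _ (\pi_F [:: l])); rewrite uE wE; apply: IHn.
- by move: szu; rewrite /= size_rcons; lia.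
- by apply: contraNneq w0 => u0; move: ru; rewrite u0 /reduced /= eqxx.
- apply: contraNneq w0 => w'0; rewrite -[w]nf_reduced // -[[::]]/(nf [::]).
  apply/eqP/pi_eq_nf/(conjg_inj (\pi_F [:: l])); rewrite wE w'0.
  by rewrite -[\pi_F [::]]/(1 : F) conj1g.
- move: ru; rewrite /reduced /= rcons_path.
  by case: (u) => //= ? ? /andP[/andP[]].
- exact: reduced_nf.
- by rewrite -uE -wE /commute -!conjMg uw.
Qed.

Lemma free_commensurable (x y : F) :
  x != 1 -> y != 1 -> commute x y -> commensurable x y.
Proof.
rewrite -[x]reprK -[y]reprK -(pi_nf (repr x)) -(pi_nf (repr y)) => x1 y1.
apply: reduced_commensurable; rewrite ?reduced_nf //.
  by apply: contraNneq x1 => ->.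
by apply: contraNneq y1 => ->.
Qed.
End ReducedWords.

Lemma commensurable_trans (G : groupType) (y x z : G) :
  commensurable x y -> commensurable y z -> commensurable x z.
Proof.
case=> n [m [n0 m0 xy]] [p [q [p0 q0 yz]]].
exists (n * p)%N, (q * m)%N; rewrite !muln_gt0 n0 m0 p0 q0; split=> //.
have yzE : y ^+ (m * p) = z ^+ (q * m) \/ y ^+ (m * p) = z ^- (q * m).
  rewrite mulnC !expgnA -(expVgn (z ^+ q)).
  by case: yz => ->; [left | right].
rewrite expgnA.
case: xy => ->; rewrite ?expVgn -expgnA; first exact: yzE.
by case: yzE => ->; rewrite ?invgK; [right | left].
Qed.

(** The exponents on the side of [x] are multiplied together along the list. *)
Lemma common_power (G : groupType) (x : G) (s : seq G) :
  {in s, forall y, commensurable x y} ->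
  exists2 N, 0 < N & {in s, forall y, exists2 m, 0 < m &
    x ^+ N = y ^+ m \/ x ^+ N = y ^- m}.
Proof.
elim: s => [|y s IHs] xs; first by exists 1%N.
have [z zs|N N0 IH] := IHs; first by apply: xs; rewrite inE zs orbT.
have [|n [m [n0 m0 xy]]] := xs y; first by rewrite inE eqxx.
exists (n * N)%N; first by rewrite muln_gt0 n0.
move=> z; rewrite inE => /predU1P[->|/IH[p p0 xz]].
  exists (m * N)%N; first by rewrite muln_gt0 m0.
  by rewrite !expgnA -expVgn; case: xy => ->; [left | right].
exists (p * n)%N; first by rewrite muln_gt0 p0.
by rewrite mulnC !expgnA -(expVgn (z ^+ p)); case: xz => ->; [left | right].
Qed.

Section Raag.
Variable Gamma : graph.
Local Notation A := (raag Gamma).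
Local Notation ec := (@edge_commutation Gamma).

Definition vgen (v : Gamma) : A := gen (R := ec) v.

Lemma vgen_commute (v w : Gamma) : adj v w -> commute (vgen v) (vgen w).
Proof.
move=> vw; rewrite /commute -[LHS]presented_piM -[RHS]presented_piM.
by apply/presented_eqP/WordRel; exists v, w.
Qed.

Lemma raag_rel (G : groupType) (h : Gamma -> G) :
  (forall x y, adj x y -> commute (h x) (h y)) ->
  forall u v, ec u v -> word_val h u = word_val h v.
Proof.
move=> hC u v [x [y [xy -> ->]]].
by rewrite !word_val_cons /word_val !big_nil !mulg1; exact: hC.
Qed.

Lemma vertex_exponent (v : Gamma) : exists a : A -> int,
  additive_on a /\ forall s, a (vgen s) = (s == v)%:R%R.
Proof.
(* The first coordinates of the Heisenberg group serve as the additive group of integers. *)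
pose h s : heisenberg := ((s == v)%:R, 0, 0)%R.
have hR : forall u w, ec u w -> word_val h u = word_val h w.
  by apply: raag_rel => x y _; congr (_, _, _); rewrite /=; ring.
exists (fun x => (presented_lift h x).1.1); split.
  by move=> x y; rewrite (presented_liftM hR).
by move=> s; rewrite (presented_lift_gen hR).
Qed.

Lemma vertex_exponent_power (v : Gamma) (a : A -> int) s u n :
  additive_on a -> (forall s, a (vgen s) = (s == v)%:R%R) -> 0 < n ->
  u = vgen s ^+ n \/ u = vgen s ^- n -> (a u == 0%R) = (s != v).
Proof.
move=> aM aE n0 uE; have -> : (a u == 0%R) = (a (vgen s ^+ n) == 0%R).
  by case: uE => -> //; rewrite additiveV // oppr_eq0.
rewrite additiveX // aE; case: (s == v) => /=.
  by rewrite pnatr_eq0; case: n n0 {uE}.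
by rewrite mul0rn eqxx.
Qed.

End Raag.

(** * Cycles in a free-by-free decomposition *)

Section Cocycle.
Variables (G : groupType) (K : groupClosed G) (a b c : G -> int).
Hypotheses (aM : additive_on a) (bM : additive_on b).
Hypothesis KJ : forall k g, k \in K -> k ^ g \in K.
Hypothesis cM : {in K &, forall x y, c (x * y) = (c x + c y + a x * b y)%R}.

(* Conjugation by [u] changes [c] by a homomorphism, as it preserves the
   restrictions of [a] and [b] to [K]. *)
Definition defect (u k : G) : int := (c (k ^ u) - c k)%R.

Lemma defect1 u : defect u 1 = 0%R.
Proof. by rewrite /defect conj1g subrr. Qed.

Lemma defectM u : {in K &, forall x y,
  defect u (x * y) = (defect u x + defect u y)%R}.
Proof.
move=> x y xK yK; rewrite /defect conjMg.
rewrite (@cM _ _ (@KJ _ u xK) (@KJ _ u yK)) (@cM _ _ xK yK).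
by rewrite (additiveJ aM) (additiveJ bM); ring.
Qed.

(** Put k = u^-1 v and e = v^-1 w, so u = v k^-1. As [v] commutes with e, conjugation by [u] sends e
    to k e k^-1, and [c] changes by the determinant of (a, b) at k and e. *)
Lemma defect_step u v w : u^-1 * v \in K -> v^-1 * w \in K -> commute v w ->
  (defect u (u^-1 * w) = defect u (u^-1 * v) +
     ((a v - a u) * (b w - b v) - (b v - b u) * (a w - a v)))%R.
Proof.
set k := u^-1 * v; set e := v^-1 * w => kK eK vw.
have -> : u^-1 * w = k * e by rewrite /k /e mulgA mulgK.
rewrite defectM //; congr (_ + _)%R.
have eE : e ^ u * k = k * e.
  have -> : u = v * k^-1 by rewrite /k invgM invgK mulVKg.
  rewrite conjgM; have -> : e ^ v = e.
    by rewrite /e conjgE -(mulgA _ w) -vw mulKg.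
  by rewrite conjgE invgK -(mulgA k) -(mulgA e) mulVg mulg1.
have := congr1 c eE.
rewrite (@cM _ _ (@KJ _ u eK) kK) (@cM _ _ kK eK) (additiveJ aM) /defect.
have -> : a e = (a w - a v)%R by rewrite aM (additiveV aM) addrC.
have -> : b e = (b w - b v)%R by rewrite bM (additiveV bM) addrC.
have -> : a k = (a v - a u)%R by rewrite aM (additiveV aM) addrC.
have -> : b k = (b v - b u)%R by rewrite bM (additiveV bM) addrC.
move=> ck; have -> : c (e ^ u) = (c (e ^ u) + c k + (a w - a v) * (b v - b u)
  - c k - (a w - a v) * (b v - b u))%R by ring.
by rewrite ck; ring.
Qed.

(** Summing [defect_step] once round the closed chain gives [defect x 1], which is 0, while the
    vanishing hypotheses leave only the term [a x * b y]. *)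
Lemma cycle_det0 (x y z : G) (s : seq G) :
  path (fun v w => v * w == w * v) x [:: y, z & rcons s x] ->
  {in x :: y :: z :: s &, forall v w, v^-1 * w \in K} ->
  {in z :: s, forall v, a v = 0%R /\ b v = 0%R} ->
  b x = 0%R -> a y = 0%R -> (a x * b y = 0)%R.
Proof.
move=> /and3P[/eqP xy /eqP yz zs] inK ab0 bx ay.
have xzE : defect x (x^-1 * z) = (a x * b y)%R.
  have [az bz] := ab0 z (mem_head _ _).
  rewrite (@defect_step x y z) ?inK ?inE ?eqxx ?orbT //.
  rewrite (@defect_step x x y) ?inK ?inE ?eqxx ?orbT // mulVg defect1.
  by rewrite az bz ay bx; ring.
(* Beyond [z] each step, including the closing one to [x], contributes 0, so the value in [xzE] is
   carried along. *)
elim: s z {xy yz} zs inK ab0 xzE => [|w s IHs] z /= /andP[/eqP zw zs] inK ab0.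
  have [az bz] := ab0 z (mem_head _ _).
  have := @defect_step x z x; rewrite !inK ?inE ?eqxx ?orbT //.
  move=> /(_ isT isT zw); rewrite mulVg defect1 az bz bx => defE <-.
  by rewrite {}defE; ring.
move=> xzE; apply: (IHs w) => //.
- move=> v v' vs vs'; apply: inK; rewrite !inE.
    by move: vs; rewrite !inE => /or4P[] ->; rewrite ?orbT.
  by move: vs'; rewrite !inE => /or4P[] ->; rewrite ?orbT.
- by move=> v vs; apply: ab0; rewrite inE vs orbT.
have [az bz] := ab0 z (mem_head _ _).
have [|aw bw] := ab0 w; first by rewrite !inE eqxx orbT.
rewrite (@defect_step x z w) ?inK ?inE ?eqxx ?orbT // xzE az bz aw bw bx.
by ring.
Qed.
End Cocycle.

Section BreakableCycles.
Variable Gamma : graph.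
Local Notation A := (raag Gamma).

Section FreeSubgroup.
Variables (H K : groupClosed A) (nHK : normal_in H K).
Hypotheses (H1 : H =i pred1 1) (freeK : is_free (quotient nHK)).

(** The determinant identity fails for the exponents of [v] and [w]. *)
Lemma adj_not_free (v w : Gamma) :
  adj v w -> vgen v \in K -> vgen w \in K -> False.
Proof.
move=> vw vK wK; have [a [aM aE]] := vertex_exponent v.
have [b [bM bE]] := vertex_exponent w.
have := free_commute_det H1 freeK aM bM vK wK (vgen_commute vw).
have /negPf wv : w != v by apply: contraTneq vw => ->; rewrite adj_irr.
by rewrite !aE !bE !eqxx wv mul0r.
Qed.

Variables (S : choiceType) (f : A -> free_group S).
Hypotheses (fM : {morph f : x y / x * y}).
Hypothesis fK : forall x, f x = 1 <-> x \in K.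
Hypothesis KJ : forall k g, k \in K -> k ^ g \in K.

Let power_of (u : A) (v : Gamma) :=
  exists2 n, 0 < n & u = vgen v ^+ n \/ u = vgen v ^- n.

Lemma power_of_commute (u u' : A) v w : adj v w -> power_of u v ->
  power_of u' w -> commute u u'.
Proof.
move=> vw [n _ uE] [m _ u'E].
have vwC := commuteX2 n m (vgen_commute vw).
case: uE => ->; case: u'E => -> //; try exact: commuteV.
- exact/commute_sym/commuteV/commute_sym.
- exact/commuteV/commute_sym/commuteV/commute_sym.
Qed.

(** Consecutive vertices have commuting nontrivial images under [f], so all images are commensurable
    with the first one; a common power of them is lifted back to powers of the vertices. *)
Lemma path_powers (x : Gamma) (s : seq Gamma) :
  path (@adj Gamma) x s -> {in x :: s, forall v, vgen v \notin K} ->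
  exists u : Gamma -> A, {in x :: s, forall v, power_of (u v) v} /\
    {in x :: s &, forall v w, (u v)^-1 * u w \in K}.
Proof.
move=> xs notK.
have neq1 v : v \in x :: s -> f (vgen v) != 1.
  by move=> vs; apply: contra (notK v vs) => /eqP /fK.
have comm : {in x :: s, forall v, commensurable (f (vgen x)) (f (vgen v))}.
  elim/last_ind: s xs notK neq1 => [|s w IHs].
    move=> _ _ _ v; rewrite inE => /eqP ->.
    by exists 1%N, 1%N; split=> //; left.
  rewrite rcons_path => /andP[xs sw] notK neq1.
  have sub v : v \in x :: s -> v \in x :: rcons s w.
    by rewrite !inE mem_rcons inE => /orP[->|->]; rewrite ?orbT.
  have IH := IHs xs (fun v vs => notK v (sub v vs))
    (fun v vs => neq1 v (sub v vs)).
  move=> v; rewrite inE mem_rcons inE orbCA => /orP[/eqP ->|vs]; last first.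
    exact: IH.
  apply: commensurable_trans (IH _ (mem_last _ _)) _.
  apply: free_commensurable.
  - exact/neq1/sub/mem_last.
  - by apply: neq1; rewrite inE mem_rcons mem_head orbT.
  - by rewrite /commute -!fM vgen_commute.
have [|N N0 common] := @common_power _ (f (vgen x))
    [seq f (vgen v) | v <- x :: s].
  by move=> _ /mapP[v vs ->]; exact: comm.
have exu v : exists u : A, v \in x :: s ->
    power_of u v /\ f u = f (vgen x) ^+ N.
  have [vs|] := boolP (v \in x :: s); last by exists 1.
  have [m m0 fE] := common _ (map_f _ vs).
  case: fE => fE; [exists (vgen v ^+ m) | exists (vgen v ^- m)] => _.
    by rewrite (morph_mulX fM) -fE; split=> //; exists m => //; left.
  rewrite (morph_mulV fM) (morph_mulX fM) -fE.
  by split=> //; exists m => //; right.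
have [u uP] := choice exu; exists u; split=> [v vs|v w vs ws].
  by have [] := uP v vs.
apply/fK; rewrite fM (morph_mulV fM) (uP v vs).2 (uP w ws).2; exact: mulVg.
Qed.

(** Otherwise the powers from [path_powers] form a closed chain of commuting elements, and
    [cycle_det0] fails for the exponents of the first two vertices. *)
Lemma cycle_meets (c : seq Gamma) : graph_cycle c ->
  exists2 v, v \in c & vgen v \in K.
Proof.
move=> [sz /andP[cyc uc]].
have [/hasP[v vc vK]|/hasPn notK] := boolP (has (fun v => vgen v \in K) c).
  by exists v.
case: c sz cyc uc notK => [|x [|y [|z s]]] // _ cyc uc notK.
have {}cyc : path (@adj Gamma) x (rcons [:: y, z & s] x) := cyc.
have xyz : path (@adj Gamma) x [:: y, z & s].
  by move: cyc; rewrite rcons_path => /andP[].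
have [u [uP uK]] := path_powers xyz notK.
have [a [aM aE]] := vertex_exponent x.
have [b [bM bE]] := vertex_exponent y.
have aP v : v \in [:: x, y, z & s] -> (a (u v) == 0%R) = (v != x).
  by move/uP=> [n n0 uE]; exact: (vertex_exponent_power aM aE n0 uE).
have bP v : v \in [:: x, y, z & s] -> (b (u v) == 0%R) = (v != y).
  by move/uP=> [n n0 uE]; exact: (vertex_exponent_power bM bE n0 uE).
have [k kM] := free_heisenberg_lift H1 freeK aM bM.
have : (a (u x) * b (u y) = 0)%R.
  apply: (cycle_det0 aM bM KJ kM (z := u z) (s := map u s)).
  - rewrite -map_rcons -!map_cons path_map.
    have sub v : v \in x :: [:: y, z & rcons s x] -> v \in [:: x, y, z & s].
      by rewrite !inE mem_rcons inE => /or4P[] => [->|->|->|/orP[]->];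
        rewrite ?orbT.
    apply: (sub_in_path (P := mem [:: x, y, z & s])) cyc; last first.
      by apply/allP => v /sub.
    move=> v w vc wc vw /=.
    by apply/eqP; exact: power_of_commute vw (uP v vc) (uP w wc).
  - rewrite -!map_cons => _ _ /mapP[v vs ->] /mapP[w ws ->]; exact: uK.
  - rewrite -map_cons => _ /mapP[v vs ->].
    have vc : v \in [:: x, y, z & s] by rewrite inE [v \in _]inE vs !orbT.
    move: uc; rewrite /= inE negb_or => /andP[/andP[_ xzs] /andP[yzs _]].
    split; apply/eqP; rewrite ?aP ?bP //; first by apply: contraNneq xzs => <-.
    by apply: contraNneq yzs => <-.
  - apply/eqP; rewrite bP ?mem_head //.
    by move: uc => /= /andP[]; rewrite inE negb_or => /andP[].
  - apply/eqP; rewrite aP ?inE ?eqxx ?orbT // eq_sym.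
    by move: uc => /= /andP[]; rewrite inE negb_or => /andP[].
by move/eqP; rewrite mulf_eq0 aP ?mem_head // bP ?inE ?eqxx ?orbT //.
Qed.

(** If [x] and [y] are the neighbours of [v] on the cycle, [v] commutes with [(u x)^-1 * u y] in
    [K]; the exponents of [v] and [x] then violate the determinant identity. *)
Lemma cycle_meets_twice (v : Gamma) (s : seq Gamma) : graph_cycle (v :: s) ->
  vgen v \in K -> exists2 w, w \in s & vgen w \in K.
Proof.
move=> [sz /andP[cyc uc]] vK.
have [/hasP[w ws wK]|/hasPn notK] := boolP (has (fun v => vgen v \in K) s).
  by exists w.
case/lastP: s sz cyc uc notK => [|[|x s] y] // _ cyc uc notK.
have {}cyc : path (@adj Gamma) v (x :: rcons (rcons s y) v) := cyc.
move: cyc; rewrite /= rcons_path last_rcons => /and3P[vx xs yv].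
have [u [uP uK]] := path_powers xs notK.
have [a [aM aE]] := vertex_exponent v.
have [b [bM bE]] := vertex_exponent x.
have xIn : x \in x :: rcons s y by exact: mem_head.
have yIn : y \in x :: rcons s y by rewrite inE mem_rcons mem_head orbT.
have vpow : power_of (vgen v) v by exists 1%N => //; left.
have kC : commute (vgen v) ((u x)^-1 * u y).
  apply: commuteM.
    exact/commuteV/(power_of_commute vx vpow)/uP.
  exact/commute_sym/(power_of_commute yv _ vpow)/uP.
have := free_commute_det H1 freeK aM bM vK (uK _ _ xIn yIn) kC.
move: uc => /= /andP[]; rewrite inE negb_or => /andP[vx' vsy] /andP[xsy _].
have pE w w' c' : additive_on c' -> (forall s, c' (vgen s) = (s == w')%:R%R) ->
    w \in x :: rcons s y -> (c' (u w) == 0%R) = (w != w').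
  move=> cM cE wIn; have [n n0 uE] := uP w wIn.
  exact: vertex_exponent_power cM cE n0 uE.
have ax : a (u x) = 0%R by apply/eqP; rewrite (pE x v) // eq_sym.
have ay : a (u y) = 0%R.
  apply/eqP; rewrite (pE y v) //; apply: contraNneq vsy => <-.
  by rewrite mem_rcons mem_head.
have by0 : b (u y) = 0%R.
  apply/eqP; rewrite (pE y x) //; apply: contraNneq xsy => <-.
  by rewrite mem_rcons mem_head.
have bx : b (u x) != 0%R by rewrite (pE x x) // negbK.
rewrite !aM !bM (additiveV aM) (additiveV bM) ax ay by0 aE eqxx bE.
rewrite !addr0 oppr0 mul1r mul0r => /eqP; rewrite oppr_eq0 => bx0.
by rewrite bx0 in bx.
Qed.

End FreeSubgroup.

(** Length 0 would make [vgen x] trivial, and length 1 would make the whole group free, against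
    [adj_not_free]. *)
Lemma poly_free_chain_length M :
  (exists x y : Gamma, adj x y) -> has_poly_free_chain A M -> 1 < M.
Proof.
case=> x [y xy] [H]; case: M => [|[|//]] [H0 HN freeH].
  have [a [aM aE]] := vertex_exponent x.
  have : vgen x \in pred1 1 by rewrite -H0 HN.
  rewrite inE => /eqP xE; have := aE x.
  by rewrite xE additive1 // eqxx.
have [nH freeK] := freeH 0 isT.
by case: (adj_not_free H0 freeK xy); rewrite HN.
Qed.

Lemma breakable_of_chain : has_poly_free_chain A 2 ->
  exists D : {pred Gamma}, {in D &, forall x y, ~~ adj x y} /\
  forall c, graph_cycle c ->
    exists x y, [/\ x \in c, y \in c, x \in D, y \in D & x != y].
Proof.
case=> H [H0 H2 freeH].
have [nH0 freeK] := freeH 0 isT; have [nH1 freeQ] := freeH 1%N isT.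
have [S [f [_ [fM _ _ fK]]]] := quotient_free_coord freeQ.
exists (fun v => vgen v \in H 1%N); split.
  move=> x y xK yK; apply/negP => xy; exact: adj_not_free H0 freeK _ _ xy xK yK.
have fM' : {morph f : x y / x * y} by move=> x y; apply: fM; rewrite H2.
have fK' x : f x = 1 <-> x \in H 1%N by apply: fK; rewrite H2.
have KJ k g : k \in H 1%N -> k ^ g \in H 1%N.
  by move=> kH; apply: (normal_conj nH1) => //; rewrite H2.
move=> c cyc; have [v vc vK] := cycle_meets H0 freeK fM' fK' KJ cyc.
have [i s cE] := rot_to vc.
have vs : graph_cycle (v :: s).
  by case: cyc => sz uc; rewrite /graph_cycle -cE size_rot rot_ucycle.
have [w ws wK] := cycle_meets_twice H0 freeK fM' fK' vs vK.
exists v, w; split=> //.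
  by rewrite -(mem_rot i) cE inE ws orbT.
by case: vs => _ /andP[_ /andP[vs _]]; apply: contraNneq vs => ->.
Qed.

End BreakableCycles.

(** * The forest outside an independent set meeting all cycles twice *)

Section Forest.
Variables (Gamma : graph) (D : {pred Gamma}).
Hypothesis D_twice : forall c, graph_cycle c ->
  exists x y : Gamma, [/\ x \in c, y \in c, x \in D, y \in D & x != y].

Definition forest_adj : rel Gamma :=
  fun v w => [&& v \notin D, w \notin D & adj v w].

Lemma forest_adj_sym : symmetric forest_adj.
Proof. by move=> v w; rewrite /forest_adj andbCA adj_sym. Qed.

Lemma forest_path_notin v p : v \notin D -> path forest_adj v p ->
  {in v :: p, forall w, w \notin D}.
Proof.
elim: p v => [|x p IHp] v vD /=; first by move=> _ w; rewrite inE => /eqP ->.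
case/andP=> /and3P[_ xD _] xp w; rewrite inE => /predU1P[-> //|].
exact: IHp xD xp w.
Qed.

Definition forest_conn (v w : Gamma) : Prop :=
  exists2 p, path forest_adj v p & last v p = w.

Lemma forest_conn_sym v w : forest_conn v w -> forest_conn w v.
Proof.
case=> p vp <-; exists (rev (belast v p)).
  rewrite rev_path (eq_path (e' := forest_adj)) // => x y.
  exact: forest_adj_sym.
by case: p {vp} => // x p; rewrite /= rev_cons last_rcons.
Qed.

Lemma forest_conn_trans v w x :
  forest_conn v w -> forest_conn w x -> forest_conn v x.
Proof.
case=> p vp pw [q wq qx]; exists (p ++ q); first by rewrite cat_path vp pw.
by rewrite last_cat pw.
Qed.

(** [choose] returns the same point for every starting vertex of a component. A vertex of [D] has no
    forest neighbour and is its own root. *)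
Definition forest_root (v : Gamma) : Gamma :=
  choose (fun w => `[< forest_conn v w >]) v.

Lemma forest_conn_refl v : forest_conn v v. Proof. by exists [::]. Qed.

Lemma forest_rootP v : forest_conn v (forest_root v).
Proof.
apply/asboolP; apply: (@chooseP _ (fun w => `[< forest_conn v w >])).
exact/asboolP/forest_conn_refl.
Qed.

Lemma forest_root_eq v w : forest_conn v w -> forest_root v = forest_root w.
Proof.
move=> vw; rewrite /forest_root.
rewrite (eq_choose (Q := fun x => `[< forest_conn w x >])).
  apply: choose_id; apply/asboolP; first exact: forest_conn_sym.
  exact: forest_conn_refl.
move=> x; apply/asboolP/asboolP; last exact: forest_conn_trans.
exact/forest_conn_trans/forest_conn_sym.
Qed.

Lemma forest_root_adj v w : forest_adj v w -> forest_root v = forest_root w.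
Proof. by move=> vw; apply: forest_root_eq; exists [:: w]; rewrite /= ?vw. Qed.

Lemma forest_root_notin v : (forest_root v \notin D) = (v \notin D).
Proof.
have [p vp <-] := forest_rootP v.
have [vD|vD] := boolP (v \in D); last first.
  by rewrite (forest_path_notin vD vp (mem_last _ _)).
case: p vp => [|w p] /=; first by rewrite vD.
by rewrite /forest_adj vD.
Qed.

Lemma forest_dist_exists v : exists n,
  `[< exists p,
    [/\ path forest_adj v p, last v p = forest_root v & size p = n] >].
Proof.
by have [p vp pr] := forest_rootP v; exists (size p); apply/asboolP; exists p.
Qed.

Definition forest_dist v : nat := ex_minn (forest_dist_exists v).

Lemma forest_dist_descent v : v != forest_root v ->
  exists w, forest_adj v w && (forest_dist w < forest_dist v).
Proof.
rewrite /forest_dist; case: (ex_minnP (forest_dist_exists v)) => n /asboolP.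
case=> [[|w p]] [vp pr <-] _ vr; first by rewrite -pr eqxx in vr.
move: vp => /= /andP[vw wp]; exists w; rewrite vw ltnS /=.
case: ex_minnP => m _; apply; apply/asboolP; exists p; split=> //.
by rewrite -(forest_root_adj vw).
Qed.

Definition parent (v : Gamma) : Gamma :=
  if pselect (exists w, forest_adj v w && (forest_dist w < forest_dist v))
    is left ex then xchoose ex else v.

Lemma parentP v : v != forest_root v ->
  forest_adj v (parent v) /\ forest_dist (parent v) < forest_dist v.
Proof.
move=> vr; rewrite /parent.
case: pselect => [ex|[]]; last exact: forest_dist_descent.
by apply/andP; exact: (xchooseP ex).
Qed.

Let parent_adj v w := [|| (v != forest_root v) && (w == parent v) |
  (w != forest_root w) && (v == parent w)].

Lemma parent_path v :
  exists2 p, path [rel x y | forest_adj x y && parent_adj x y] v p &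
    last v p = forest_root v.
Proof.
have [n] := ubnP (forest_dist v); elim: n v => // n IHn v dv.
have [vr|vr] := eqVneq v (forest_root v); first by exists [::].
have [vp lt] := parentP vr.
have [|p pp pr] := IHn (parent v); first by apply: leq_trans lt _.
exists (parent v :: p); last by rewrite /= pr (forest_root_adj vp).
by rewrite /= vp pp /parent_adj vr eqxx.
Qed.

(* An edge of the forest other than those to the parents would close a path
   through the root to a cycle. *)
Lemma forest_adj_parent v w : forest_adj v w -> parent_adj v w.
Proof.
move=> vw; have [p vp pr] := parent_path v; have [q wq qr] := parent_path w.
set e := [rel x y | _] in vp wq.
have e_sym : symmetric e.
  by move=> x y; rewrite /e /= forest_adj_sym /parent_adj orbC.
have vpq : path e v (p ++ rev (belast w q)).
  rewrite cat_path vp pr (forest_root_adj vw) -qr rev_path.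
  by rewrite (eq_path (e' := e)).
have lastE : last v (p ++ rev (belast w q)) = w.
  rewrite last_cat pr (forest_root_adj vw) -qr.
  by case: (q) => // x q'; rewrite /= rev_cons last_rcons.
case/shortenP: vpq lastE => {p q vp pr wq qr} p vp uvp _ lastE.
have [vD wD adjvw] := and3P vw.
(* Length 0 would make the edge a loop, length 1 makes it a parent edge, and a longer path closes up
   to a cycle avoiding [D]. *)
case: p vp uvp lastE => [_ _ /= vwE|x [|y p]].
- by rewrite vwE adj_irr in adjvw.
- by move=> /= /andP[/andP[_ vx] _] _ <-.
move=> vp uvp lastE.
have vp' : path forest_adj v [:: x, y & p].
  by apply: sub_path vp => ? ? /andP[].
have [|a [b [ac _ aD _ _]]] := D_twice (c := [:: v, x, y & p]).
  split=> //; apply/andP; split=> //.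
  rewrite (cycle_path v) [last _ _]lastE /= -[adj x y && _]/(path _ x (y :: p)).
  rewrite adj_sym adjvw /=; apply: (sub_path (e := forest_adj)) vp' => ? ?.
  by case/and3P.
by have := forest_path_notin vD vp' ac; rewrite aD.
Qed.

(** A tree path between distinct [v] and [w] would close through [d] to a cycle meeting [D] only in
    [d]. *)
Lemma adj_forest_unique d v w : d \in D -> v \notin D -> w \notin D ->
  adj d v -> adj d w -> forest_root v = forest_root w -> v = w.
Proof.
move=> dD vD wD dv dw vw.
have [p vp pw] : forest_conn v w.
  apply: forest_conn_trans (forest_rootP v) _; rewrite vw.
  exact/forest_conn_sym/forest_rootP.
case/shortenP: vp pw => {}p vp uvp _ pw.
case: p vp uvp pw => [//|x p] vp uvp pw.
have notD := forest_path_notin vD vp.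
have [|a [b [ac bc aD bD]]] := D_twice (c := [:: d, v, x & p]).
  split=> //; apply/andP; split; last first.
    by rewrite cons_uniq uvp andbT; apply: contraL dD => /notD.
  rewrite (cycle_path d) [last _ _]pw /= adj_sym dw dv /=.
  apply: (sub_path (e := forest_adj)) vp => ? ?; by case/and3P.
have onlyd c : c \in [:: d, v, x & p] -> c \in D -> c = d.
  by rewrite inE => /predU1P[-> //|/notD/negPf ->].
by rewrite (onlyd a ac aD) (onlyd b bc bD) eqxx.
Qed.

Definition tree : choiceType :=
  {v : Gamma | (v \notin D) && (forest_root v == v)}.

Definition tree_of (v : Gamma) : option tree := insub (forest_root v).

Lemma tree_of_notin v T :
  tree_of v = Some T -> v \notin D /\ forest_root v = val T.
Proof.
rewrite /tree_of; case: insubP => // T' /andP[vD _] TE [<-].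
by rewrite -forest_root_notin.
Qed.

Lemma tree_of_eq v w : forest_root v = forest_root w -> tree_of v = tree_of w.
Proof. by rewrite /tree_of => ->. Qed.

Lemma tree_of_None v : tree_of v = None <-> v \in D.
Proof.
rewrite /tree_of; case: insubP => [T /andP[vD _] _|].
  by split=> // vD'; rewrite forest_root_notin vD' in vD.
rewrite forest_root_notin -(forest_root_eq (forest_rootP v)) eqxx andbT negbK.
by [].
Qed.

Lemma tree_of_root (T : tree) : tree_of (val T) = Some T.
Proof.
have /andP[_ /eqP TE] := valP T.
by rewrite /tree_of TE valK.
Qed.

(** Orients the edges of the graph: [v] points to the vertex whose relation with [v] is used to
    eliminate kernel elements of [v]. *)
Definition link (v : Gamma) (T : tree) : option Gamma :=
  if tree_of v is Some T' then
    if (T' == T) && (v != forest_root v) then Some (parent v) else None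
  else if pselect (exists w, adj v w && (tree_of w == Some T)) is left ex
  then Some (xchoose ex) else None.

Lemma linkP v T w : link v T = Some w ->
  [/\ adj v w, tree_of w = Some T &
    tree_of v = None \/
    tree_of v = Some T /\ forest_dist w < forest_dist v].
Proof.
rewrite /link; case vE : (tree_of v) => [T'|]; last first.
  case: pselect => // ex [<-]; have /andP[vw /eqP wT] := xchooseP ex.
  by split=> //; left.
case: andP => // -[/eqP <- vr] [<-]; have [vp lt] := parentP vr.
have [_ _ adjvp] := and3P vp; split=> //; last by right.
by rewrite -vE; apply/esym/tree_of_eq/forest_root_adj.
Qed.

Lemma link_root (T T' : tree) : link (val T) T' = None.
Proof.
have /andP[_ /eqP TE] := valP T.
by rewrite /link tree_of_root TE eqxx andbF.
Qed.

(** Inside a tree links lower the distance to the root; from [D] the first link enters a tree, and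
    no link returns to [D]. *)
Lemma link_wf : well_founded (fun w v => exists T, link v T = Some w).
Proof.
have treeAcc n v : tree_of v <> None -> forest_dist v < n ->
    Acc (fun w v => exists T, link v T = Some w) v.
  elim: n v => [v _|n IHn v vT]; first by rewrite ltn0.
  rewrite ltnS => dv; constructor=> w [T /linkP[_ wT [vN|[_ lt]]]].
    by case: vT.
  by apply: IHn (leq_trans lt dv); rewrite wT.
move=> v; constructor=> w [T /linkP[_ wT _]].
by apply: (treeAcc _ _ _ (ltnSn _)); rewrite wT.
Qed.

Hypothesis D_indep : {in D &, forall x y : Gamma, ~~ adj x y}.

(** Forest edges are parent edges. By independence any other edge has exactly one end in [D], whose
    neighbour in that tree is unique. *)
Lemma adj_link v w : adj v w ->
  exists T, link v T = Some w \/ link w T = Some v.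
Proof.
have linkD d x T : tree_of d = None -> tree_of x = Some T -> adj d x ->
    link d T = Some x.
  move=> dN xT dx; rewrite /link dN; case: pselect => [ex|[]]; last first.
    by exists x; rewrite dx xT eqxx.
  have /andP[dy /eqP yT] := xchooseP ex; congr Some.
  have [xD xr] := tree_of_notin xT; have [yD yr] := tree_of_notin yT.
  apply: (@adj_forest_unique d) => //; last by rewrite xr yr.
  exact/tree_of_None.
move=> vw; case vE : (tree_of v) => [T|]; case wE : (tree_of w) => [T'|].
- have [vD _] := tree_of_notin vE; have [wD _] := tree_of_notin wE.
  have fvw : forest_adj v w by rewrite /forest_adj vD wD.
  exists T; have := forest_adj_parent fvw; rewrite /parent_adj /link vE wE.
  have -> : T' = T.
    by apply: Some_inj; rewrite -vE -wE; apply/esym/tree_of_eq/forest_root_adj.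
  by rewrite eqxx => /orP[] /andP[-> /eqP ->]; [left | right].
- by exists T; right; apply: linkD => //; rewrite adj_sym.
- by exists T'; left; exact: linkD.
- have vD := (tree_of_None v).1 vE; have wD := (tree_of_None w).1 wE.
  by rewrite (negPf (D_indep vD wD)) in vw.
Qed.

End Forest.

(** * A basis of the kernel *)

Section KernelBasis.
Variables (Gamma : graph) (C : choiceType).
Variables (comp : Gamma -> option C) (rt : C -> Gamma).
(* [lk v T] is the parent of v if v lies in the tree T, and the unique neighbour
   of v in T if v lies in no tree. *)
Variable lk : Gamma -> C -> option Gamma.
Hypothesis lk_wf : well_founded (fun w v => exists T, lk v T = Some w).
Hypothesis lkP : forall v T w, lk v T = Some w ->
  [/\ adj v w, comp w = Some T & comp v = None \/ comp v = Some T].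
Hypothesis adj_lk : forall v w, adj v w ->
  exists T, lk v T = Some w \/ lk w T = Some v.
Hypothesis comp_rt : forall T, comp (rt T) = Some T.
Hypothesis lk_rt : forall T T', lk (rt T) T' = None.

Local Notation A := (raag Gamma).
Local Notation F := (free_group C).

Definition comp_gen (v : Gamma) : F := if comp v is Some T then gen T else 1.

Lemma lk_comp_commute v T w : lk v T = Some w ->
  commute (comp_gen v) (comp_gen w).
Proof.
case/lkP=> _ wT [vN|vT]; rewrite /comp_gen wT ?vN ?vT //.
exact/commute_sym/commute1.
Qed.

(** The projection p of the overview; [rt_lift] below is its section s. *)
Definition comp_map : A -> F := presented_lift comp_gen.

Let comp_rel : forall u v, edge_commutation u v ->
  word_val comp_gen u = word_val comp_gen v.
Proof.
apply: raag_rel => v w /adj_lk[T [/lk_comp_commute //|/lk_comp_commute]].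
exact: commute_sym.
Qed.

Lemma comp_mapM : {morph comp_map : x y / x * y}.
Proof. exact: presented_liftM comp_rel. Qed.

Lemma comp_map_vgen v : comp_map (vgen v) = comp_gen v.
Proof. exact: (presented_lift_gen comp_rel v). Qed.

Definition rt_lift : F -> A := presented_lift (fun T => vgen (rt T)).

Lemma rt_liftM : {morph rt_lift : x y / x * y}.
Proof. exact/presented_liftM/free_group_rel. Qed.

Lemma rt_liftK : cancel rt_lift comp_map.
Proof.
apply: (@presented_ext _ _ _ (comp_map \o rt_lift) id) => //.
  by move=> x y; rewrite /= rt_liftM comp_mapM.
move=> T; rewrite /= /rt_lift (presented_lift_gen (free_group_rel _)).
by rewrite comp_map_vgen /comp_gen comp_rt.
Qed.

(* The pair (v, g) stands for [kernel_elt v g] below. It is left out of the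
   basis if g begins with a letter to which v is linked, as then the relation
   between v and its link expresses it by the elements for shorter words. *)
Definition basis_pred (p : Gamma * word C) : bool :=
  [&& reduced p.2, (if p.2 is l :: _ then lk p.1 l.1 == None else true) &
      if comp p.1 is Some T then rt T != p.1 else true].

Definition basis : choiceType := {p : Gamma * word C | basis_pred p}.
Local Notation E := (free_group basis).

(** Left multiplication by the image of [v] in [F], on reduced words. *)
Definition shift (v : Gamma) (g : word C) : word C :=
  if comp v is Some T then push (T, true) g else g.

Definition unshift (v : Gamma) (g : word C) : word C :=
  if comp v is Some T then push (T, false) g else g.

Lemma reduced_shift v g : reduced g -> reduced (shift v g).
Proof. by rewrite /shift; case: comp => // T; exact: reduced_push. Qed.

Lemma reduced_unshift v g : reduced g -> reduced (unshift v g).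
Proof. by rewrite /unshift; case: comp => // T; exact: reduced_push. Qed.

Lemma shiftK v g : reduced g -> unshift v (shift v g) = g.
Proof.
by rewrite /shift /unshift; case: comp => // T; exact: (@pushK _ (T, true)).
Qed.

Lemma unshiftK v g : reduced g -> shift v (unshift v g) = g.
Proof.
by rewrite /shift /unshift; case: comp => // T; exact: (@pushK _ (T, false)).
Qed.

Lemma lk_shiftC v T w g : lk v T = Some w ->
  shift v (shift w g) = shift w (shift v g).
Proof. by case/lkP=> _ wT [vN|vT]; rewrite /shift wT ?vN ?vT. Qed.

Lemma pi_shift v g : \pi_F (shift v g) = comp_gen v * \pi_F g.
Proof.
rewrite /shift /comp_gen; case: comp => [T|]; last by rewrite mul1g.
by rewrite pi_push -cat1s free_piM.
Qed.

(** For the pairs reached by [cocycle_step] with a reduced word, the default 1 occurs only at roots,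
    whose kernel elements are trivial. *)
Definition basis_gen v g : E :=
  if insub (v, g) is Some p then gen (p : basis) else 1.

(* Writes [kernel_elt v g] in the free generators, given by [Phi] the same for
   the vertices linked to [v]. *)
Fixpoint cocycle_step (Phi : Gamma -> word C -> E) v (g : word C) : E :=
  if g is l :: g' then
    if lk v l.1 is Some w then
      if l.2 then Phi w (shift v g') * cocycle_step Phi v g' * (Phi w g')^-1
      else (Phi w (shift v g))^-1 * cocycle_step Phi v g' * Phi w g
    else basis_gen v g
  else basis_gen v g.

Lemma cocycle_step_ext Phi Psi v :
  (forall T w, lk v T = Some w -> Phi w =1 Psi w) ->
  cocycle_step Phi v =1 cocycle_step Psi v.
Proof.
move=> PP; elim=> //= l g IHg; case vw : (lk v l.1) => [w|] //.
by rewrite !(PP _ _ vw) IHg.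
Qed.

(** [pselect] supplies the link proof required by the recursion; its default is never met, as
    [cocycle_step] evaluates [Phi] only at links of [v]. *)
Definition cocycle : Gamma -> word C -> E :=
  Fix lk_wf (fun _ => word C -> E) (fun v rec => cocycle_step (fun w =>
    if pselect (exists T, lk v T = Some w) is left vw then rec w vw
    else fun=> 1) v).

Lemma cocycleE v : cocycle v = cocycle_step cocycle v.
Proof.
rewrite {1}/cocycle Fix_eq -/cocycle.
  apply/funext; apply: cocycle_step_ext => T w vw.
  by case: pselect => // -[]; exists T.
move=> x f g fg; apply/funext; apply: cocycle_step_ext => T w _.
by case: pselect => // p; rewrite fg.
Qed.

Lemma cocycle_cons v l g w : lk v l.1 = Some w -> cocycle v (l :: g) =
  if l.2 then cocycle w (shift v g) * cocycle v g * (cocycle w g)^-1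
  else (cocycle w (shift v (l :: g)))^-1 * cocycle v g * cocycle w (l :: g).
Proof. by move=> vw; rewrite [cocycle v]cocycleE /= vw. Qed.

(** If [g] begins with the inverse of [T], the shift shortens it, and the identity is the defining
    equation at [g] solved for the other element. *)
Lemma cocycle_shift v T w g : lk v T = Some w ->
  cocycle v (shift w g) =
  cocycle w (shift v g) * cocycle v g * (cocycle w g)^-1.
Proof.
move=> vw; have [_ wT _] := lkP vw; rewrite {1}/shift wT.
case: g => [|l g]; first by rewrite (cocycle_cons _ (l := (T, true)) vw).
rewrite /push; case: eqP => [->|_]; last first.
  by rewrite (cocycle_cons _ (l := (T, true)) vw).
rewrite (cocycle_cons _ (l := (T, false)) vw) /=.
by rewrite !mulgA mulgV mul1g mulgK.
Qed.

Lemma cocycle_comm v w g : adj v w ->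
  cocycle v (shift w g) * cocycle w g = cocycle w (shift v g) * cocycle v g.
Proof.
case/adj_lk=> T [vw|wv]; first by rewrite (cocycle_shift _ vw) mulgVK.
by rewrite (cocycle_shift _ wv) mulgVK.
Qed.

Lemma cocycle_rt T g : cocycle (rt T) g = 1.
Proof.
rewrite cocycleE; have -> : cocycle_step cocycle (rt T) g = basis_gen (rt T) g.
  by case: g => //= l g; rewrite lk_rt.
rewrite /basis_gen insubF // /basis_pred /= comp_rt eqxx.
by rewrite !andbF.
Qed.

Lemma cocycle_basis (p : basis) : cocycle (val p).1 (val p).2 = gen p.
Proof.
have /and3P[_ pl _] := valP p; rewrite cocycleE.
have -> : cocycle_step cocycle (val p).1 (val p).2 =
    basis_gen (val p).1 (val p).2.
  by case: (val p).2 pl => //= l g /eqP ->.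
by rewrite /basis_gen -surjective_pairing valK.
Qed.

Definition kernel_elt v g : A :=
  (rt_lift (\pi_F (shift v g)))^-1 * vgen v * rt_lift (\pi_F g).

(** This is the relation vw = wv rewritten in the kernel; [cocycle] satisfies the same identity. *)
Lemma kernel_elt_shift v T w g : lk v T = Some w ->
  kernel_elt v (shift w g) =
  kernel_elt w (shift v g) * kernel_elt v g * (kernel_elt w g)^-1.
Proof.
move=> vw; have [adjvw _ _] := lkP vw; rewrite /kernel_elt (lk_shiftC _ vw).
rewrite !invgM invgK !mulgA mulgK mulgK; congr (_ * _).
rewrite -!mulgA; congr (_ * _); rewrite !mulgA.
by rewrite -(vgen_commute adjvw) mulgK.
Qed.

Definition basis_lift : E -> A :=
  presented_lift (fun p : basis => kernel_elt (val p).1 (val p).2).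

Lemma basis_liftM : {morph basis_lift : x y / x * y}.
Proof. exact/presented_liftM/free_group_rel. Qed.

Lemma basis_lift_gen p : basis_lift (gen p) = kernel_elt (val p).1 (val p).2.
Proof. exact: (presented_lift_gen (free_group_rel _)). Qed.

Lemma kernel_elt_rt T g : kernel_elt (rt T) g = 1.
Proof.
rewrite /kernel_elt pi_shift /comp_gen comp_rt rt_liftM.
have -> : rt_lift (gen T) = vgen (rt T).
  exact: (presented_lift_gen (free_group_rel _)).
by rewrite -mulgA mulVg.
Qed.

(** Both sides obey the same shift identity; induction along links and then on [g] reduces to basis
    elements and roots. *)
Lemma basis_lift_cocycle v g : reduced g ->
  basis_lift (cocycle v g) = kernel_elt v g.
Proof.
elim: v / (lk_wf v) g => v _ IHv.
have basisE g : reduced g -> (if g is l :: _ then lk v l.1 == None else true) ->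
    basis_lift (basis_gen v g) = kernel_elt v g.
  move=> rg gl; rewrite /basis_gen; case: insubP => [p _ pE|].
    by rewrite basis_lift_gen pE.
  rewrite /basis_pred /= rg gl /=; case: comp => // T /negPn/eqP <-.
  by rewrite kernel_elt_rt (morph_mul1 basis_liftM).
rewrite cocycleE; elim=> [|[T b] g IHg] rg /=; first exact: basisE.
have rg' := reduced_behead rg.
case vw : (lk v T) => [w|]; last by apply: basisE => //=; rewrite vw.
have vwex : exists T, lk v T = Some w by exists T.
have [_ wT _] := lkP vw; case: b rg => rg.
  have gE : (T, true) :: g = shift w g.
    rewrite /shift wT; case: g rg {IHg rg'} => //= l g.
    by rewrite /reduced /= => /andP[/negPf ->].
  rewrite gE (kernel_elt_shift _ vw) !basis_liftM (morph_mulV basis_liftM).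
  by rewrite IHg // !IHv // reduced_shift.
have gE : g = shift w ((T, false) :: g) by rewrite /shift wT /= eqxx.
rewrite !basis_liftM (morph_mulV basis_liftM) IHg // !IHv ?reduced_shift //.
rewrite {2}gE (kernel_elt_shift _ vw).
move: (kernel_elt w (shift _ _)) => x.
move: (kernel_elt v _) (kernel_elt w _) => y z.
by rewrite !mulgA mulVg mul1g mulgVK.
Qed.

Lemma comp_map_kernel_elt v g : comp_map (kernel_elt v g) = 1.
Proof.
rewrite /kernel_elt !comp_mapM (morph_mulV comp_mapM) !rt_liftK comp_map_vgen.
by rewrite pi_shift -mulgA mulVg.
Qed.

Lemma comp_map_basis_lift e : comp_map (basis_lift e) = 1.
Proof.
apply: (@presented_ext _ _ _ (comp_map \o basis_lift) (fun=> 1)) => [x y|x y|p].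
- by rewrite /= basis_liftM comp_mapM.
- by rewrite mulg1.
- by rewrite /= basis_lift_gen comp_map_kernel_elt.
Qed.

(* The action of the generators by left multiplication on
   A = rt_lift F * basis_lift E. *)
Definition letter_act (l : Gamma * bool) (x : word C * E) : word C * E :=
  if l.2 then (shift l.1 x.1, cocycle l.1 x.1 * x.2)
  else (unshift l.1 x.1, (cocycle l.1 (unshift l.1 x.1))^-1 * x.2).

Definition word_act (u : word Gamma) (x : word C * E) := foldr letter_act x u.

Lemma reduced_letter_act l x : reduced x.1 -> reduced (letter_act l x).1.
Proof.
by case: l => v [] rx; [exact: reduced_shift | exact: reduced_unshift].
Qed.

Lemma reduced_word_act u x : reduced x.1 -> reduced (word_act u x).1.
Proof. by move=> rx; elim: u => //= l u; exact: reduced_letter_act. Qed.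

(** Makes the action of the group well defined: edge relations hold by [cocycle_comm], and
    cancellation uses that [shift] and [unshift] are inverse on reduced words. *)
Lemma word_act_eq u v x : word_eq (@edge_commutation Gamma) u v ->
  reduced x.1 -> word_act u x = word_act v x.
Proof.
move=> uv; elim: uv x => {u v} //.
- by move=> u v _ IH x rx; rewrite IH.
- by move=> u v w _ IH _ IH' x rx; rewrite IH // IH'.
- move=> u u' v v' _ IHu _ IHv x rx; rewrite /word_act !foldr_cat.
  by rewrite -!/(word_act _ _) IHv // IHu // reduced_word_act.
- move=> [v []] [g e] rg; rewrite /= /letter_act /=.
    by rewrite unshiftK // mulVKg.
  by rewrite shiftK // mulKg.
- move=> _ _ [v [w [vw -> ->]]] [g e] _; rewrite /= /letter_act /=.
  rewrite !mulgA (cocycle_comm _ vw); congr (_, _).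
  by have [T [lk_vw|lk_wv]] := adj_lk vw;
    rewrite ?(lk_shiftC _ lk_vw) ?(lk_shiftC _ lk_wv).
Qed.

Definition act (a : A) (x : word C * E) : word C * E := word_act (repr a) x.

Lemma act_pi u x : reduced x.1 -> act (\pi_A u) x = word_act u x.
Proof. exact/word_act_eq/word_eq_repr. Qed.

Lemma actM a b x : reduced x.1 -> act (a * b) x = act a (act b x).
Proof.
move=> rx; rewrite -[a in LHS]reprK -[b in LHS]reprK -presented_piM act_pi //.
by rewrite /word_act foldr_cat.
Qed.

Lemma reduced_act a x : reduced x.1 -> reduced (act a x).1.
Proof. exact: reduced_word_act. Qed.

Lemma act1 x : reduced x.1 -> act 1 x = x.
Proof. by move=> rx; rewrite (act_pi [::]). Qed.

Lemma actV_eq a x y : reduced x.1 -> act a x = y -> act a^-1 y = x.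
Proof. by move=> rx <-; rewrite -actM // mulVg act1. Qed.

Lemma act_vgen v x : reduced x.1 ->
  act (vgen v) x = (shift v x.1, cocycle v x.1 * x.2).
Proof. exact: (act_pi [:: (v, true)]). Qed.

Lemma act_rt_lift g e : reduced g -> act (rt_lift (\pi_F g)) ([::], e) = (g, e).
Proof.
elim: g => [|[T b] g IHg] rg; first by rewrite (morph_mul1 rt_liftM) act1.
have rg' := reduced_behead rg.
rewrite -cat1s free_piM rt_liftM actM // IHg //.
have pushE : push (T, b) g = (T, b) :: g.
  by case: g rg {IHg rg'} => //= l g; rewrite /reduced /= => /andP[/negPf ->].
have -> : rt_lift (\pi_F [:: (T, b)]) = \pi_A [:: (rt T, b)].
  rewrite /rt_lift presented_liftE; last exact: free_group_rel.
  by rewrite word_val1 [RHS]pi_word_val word_val1.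
rewrite act_pi // /word_act /= /letter_act /=.
case: b pushE {rg} => pushE; rewrite cocycle_rt ?invg1 mul1g /shift /unshift;
  by rewrite comp_rt pushE.
Qed.

Lemma act_kernel_elt v g e : reduced g ->
  act (kernel_elt v g) ([::], e) = ([::], cocycle v g * e).
Proof.
move=> rg; have rsg := reduced_shift v rg; rewrite /kernel_elt.
rewrite actM // act_rt_lift // actM // act_vgen //; apply: actV_eq => //.
exact: act_rt_lift.
Qed.

(** The orbit of [([::], 1)] thus recovers [e'] from its image, which gives injectivity. *)
Lemma act_basis_lift e' e : act (basis_lift e') ([::], e) = ([::], e' * e).
Proof.
have actgen p f : act (basis_lift (gen p)) ([::], f) = ([::], gen p * f).
  have /and3P[rp _ _] := valP p.
  by rewrite basis_lift_gen act_kernel_elt // cocycle_basis.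
move: e' e; apply: presented_ind => [|p x IHx|p x IHx] e.
- by rewrite (morph_mul1 basis_liftM) act1 // mul1g.
- by rewrite basis_liftM actM // IHx actgen mulgA.
- rewrite basis_liftM actM // IHx (morph_mulV basis_liftM).
  by apply: actV_eq => //; rewrite actgen -mulgA mulVKg.
Qed.

(** The map from pairs to products is equivariant; at [([::], 1)] it factors every [a] through the
    section and the kernel. *)
Lemma act_decomp a x : reduced x.1 ->
  rt_lift (\pi_F (act a x).1) * basis_lift (act a x).2 =
  a * (rt_lift (\pi_F x.1) * basis_lift x.2).
Proof.
have letterE v y : reduced y.1 ->
    rt_lift (\pi_F (act (vgen v) y).1) * basis_lift (act (vgen v) y).2 =
    vgen v * (rt_lift (\pi_F y.1) * basis_lift y.2).
  move=> ry; rewrite act_vgen // basis_liftM basis_lift_cocycle //.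
  by rewrite /kernel_elt !mulgA mulgV mul1g.
move: a x; apply: presented_ind => [|v a IHa|v a IHa] x rx.
- by rewrite act1 // mul1g.
- by rewrite actM // letterE ?reduced_act // IHa // mulgA.
- rewrite actM //; set y := act (gen v)^-1 _.
  have ry : reduced y.1 by do 2!apply: reduced_act.
  have yE : act (vgen v) y = act a x.
    by rewrite -actM ?reduced_act // mulgV act1 // reduced_act.
  apply: (@mulgI _ (vgen v)); rewrite -letterE // yE IHa // !mulgA.
  by rewrite mulgV mul1g.
Qed.

Lemma basis_lift_surj a : comp_map a = 1 -> exists e, basis_lift e = a.
Proof.
move=> a1; have := @act_decomp a ([::], 1) isT.
have := @reduced_act a ([::], 1) isT; case: (act a _) => g e /= rg.
rewrite (morph_mul1 basis_liftM) (morph_mul1 rt_liftM) !mulg1 => aE.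
exists e; have := congr1 comp_map aE.
(* Applying p kills the kernel factor, so the reduced word [g] represents 1 and is empty. *)
rewrite comp_mapM rt_liftK comp_map_basis_lift mulg1 a1 => /pi_eq_nf.
rewrite nf_reduced // => g0; rewrite g0 in aE; rewrite -aE.
by rewrite (morph_mul1 rt_liftM) mul1g.
Qed.

Lemma basis_lift_inj e : basis_lift e = 1 -> e = 1.
Proof.
move=> e1; have := act_basis_lift e 1.
by rewrite e1 act1 // mulg1 => -[].
Qed.

End KernelBasis.

(** * Assembling the chains *)

Section SubgroupExamples.
Variable G : groupType.

Lemma kernel_closed (H : groupType) (f : G -> H) :
  {morph f : x y / x * y} ->
  exists K : groupClosed G, forall x, x \in K = (f x == 1).
Proof.
move=> fM; pose K : {pred G} := fun x => f x == 1.
have K1 : 1 \in K by rewrite unfold_in /K morph_mul1.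
have KM : mulg_closed K.
  by move=> x y /eqP x1 /eqP y1; rewrite unfold_in /K fM x1 y1 mulg1.
have KV : invg_closed K.
  by move=> x /eqP x1; rewrite unfold_in /K morph_mulV // x1 invg1.
pose K' : groupClosed G := HB.pack K (isMulClosed.Build G K KM)
  (isMul1Closed.Build G K K1) (isInvClosed.Build G K KV).
by exists K'.
Qed.

Lemma trivial_closed : exists K : groupClosed G, K =i pred1 1.
Proof. by have [K KE] := @kernel_closed G id (fun _ _ => erefl); exists K. Qed.

Lemma full_closed : exists K : groupClosed G, K =i predT.
Proof.
have [K KE] := @kernel_closed G (fun=> 1) (fun _ _ => esym (mulg1 1)).
by exists K => x; rewrite KE eqxx.
Qed.
End SubgroupExamples.

(** Without edges there are no commutation relations, so the group is free on the vertices. *)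
Lemma edgeless_chain (Gamma : graph) :
  ~ (exists x y : Gamma, adj x y) -> has_poly_free_chain (raag Gamma) 1.
Proof.
move=> noadj; have [H0 H0E] := trivial_closed (raag Gamma).
have [H1 H1E] := full_closed (raag Gamma).
exists (fun i => if i is 0 then H0 else H1); split=> // -[|//] _.
have nH : normal_in H0 H1.
  split=> x; first by rewrite H1E.
  by move=> y; rewrite !H0E !inE => /eqP -> _; rewrite conj1g.
exists nH; pose phi : free_group Gamma -> raag Gamma :=
  presented_lift (@vgen Gamma).
have phi_pi u : phi (\pi u) = \pi u.
  by rewrite /phi presented_liftE ?[RHS]pi_word_val.
apply: (@quotient_is_free _ _ _ nH Gamma phi).
- exact/presented_liftM/free_group_rel.
- by move=> x; rewrite H1E.
- move=> x; rewrite H0E inE -[x]reprK phi_pi => /eqP x1.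
  apply/presented_eqP; move/presented_eqP: x1.
  elim=> {x} [u|u v _|u v w _ uv _|u u' v v' _ uu' _|l|u v [x [y [xy _ _]]]].
  + exact: WordRefl.
  + exact: WordSym.
  + exact: WordTrans.
  + exact: WordCat.
  + exact: WordCancel.
  + by case: noadj; exists x, y.
- move=> a _; exists (\pi_(free_group Gamma) (repr a)).
  by rewrite phi_pi reprK mulVg gpred1.
Qed.

Lemma chain_of_breakable (Gamma : graph) :
  doubly_breakable_cycle_property Gamma -> has_poly_free_chain (raag Gamma) 2.
Proof.
case=> _ [D [Dindep Dtwice]].
have lk_wf := @link_wf Gamma D; have adj_lk := adj_link Dtwice Dindep.
pose comp := @tree_of Gamma D; pose lk := @link Gamma D.
have lkP v T w : lk v T = Some w ->
    [/\ adj v w, comp w = Some T & comp v = None \/ comp v = Some T].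
  by case/linkP=> vw wT [vN|[vT _]]; split=> //; [left | right].
have comp_rt (T : tree D) : comp (val T) = Some T by exact: tree_of_root.
have lk_rt (T T' : tree D) : lk (val T) T' = None by exact: link_root.
have fM := comp_mapM lkP adj_lk; set f := comp_map comp in fM.
have [H0 H0E] := trivial_closed (raag Gamma).
have [H1 H1E] := kernel_closed fM.
have [H2 H2E] := full_closed (raag Gamma).
exists (fun i => match i with 0 => H0 | 1 => H1 | _ => H2 end); split=> //.
(* The kernel of [f] is free on [basis], and the quotient by it is the free group on the trees,
   lifted by the roots. *)
case=> [|[|//]] _.
  have nH : normal_in H0 H1.
    split=> [x|x y]; rewrite !H0E !inE => /eqP ->; last by rewrite conj1g.
    by rewrite H1E morph_mul1.
  exists nH.
  apply: (@quotient_is_free _ _ _ nH _ (@basis_lift _ _ comp val lk)).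
  - exact: basis_liftM.
  - by move=> e; rewrite H1E; apply/eqP/(comp_map_basis_lift lkP adj_lk).
  - move=> e; rewrite H0E inE => /eqP.
    exact: (basis_lift_inj lk_wf lkP adj_lk comp_rt lk_rt).
  - move=> k; rewrite H1E => /eqP.
    case/(basis_lift_surj lk_wf lkP adj_lk comp_rt) => e <-.
    by exists e; rewrite mulVg gpred1.
have nH : normal_in H1 H2.
  split=> [x|x y]; first by rewrite H2E.
  rewrite !H1E /conjg !fM (morph_mulV fM) => /eqP -> _.
  by rewrite mul1g mulVg.
have rK x : f (rt_lift val x) = x by exact: (rt_liftK lkP adj_lk comp_rt).
exists nH; apply: (@quotient_is_free _ _ _ nH _ (rt_lift (C := tree D) val)).
- exact: rt_liftM.
- by move=> x; rewrite H2E.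
- by move=> x; rewrite H1E rK => /eqP.
- move=> a _; exists (f a).
  by rewrite H1E fM (morph_mulV fM) rK mulVg.
Qed.

Theorem theoremB (Gamma : graph) :
  pfl_eq (raag Gamma) 2 <-> doubly_breakable_cycle_property Gamma.
Proof.
split=> [[chain2 minimal]|breakable].
  split; last exact: breakable_of_chain.
  (* An edge must exist, since otherwise a chain of length 1 contradicts minimality. *)
  have [//|noadj] := pselect (exists x y : Gamma, adj x y).
  by have := minimal 1%N (edgeless_chain noadj).
split; first exact: chain_of_breakable.
by move=> M; apply: poly_free_chain_length; case: breakable.
Qed.
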